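(* In dimension $d=1$, let $\mathcal U$ be an up-family and consider the attractive CA $\upsilon=\delta_{\mathcal U}$. Then $\upsilon$ is an eroder if and only if its version with small enough death rate $1-p$ has an invariant measure different from $\delta_{\mathbf 0}$, i.e. if and only if there exists $\varepsilon\in(0,1)$ such that for all $p\in[1-\varepsilon,1)$ the attractive PCA $\widetilde\upsilon=p\,\delta_{\mathcal U}+(1-p)\,\delta_{\varnothing}$ has an invariant measure different from $\delta_{\mathbf 0}$.
   Context: Here $d=1$; fix a range $r\in[1,\infty)$ and set $R=([-r,r]^d\times[-r,0))\cap\mathbb Z^{d+1}$. For any set $X$, elements of $\{0,1\}^X$ are identified with subsets of $X$ (the set of points with value $1$). A configuration is an element of $\Omega=\{0,1\}^{\mathbb Z^d\times([-r,0)\cap\mathbb Z)}$. Let $\Omega_R=\{0,1\}^R$, identified with the power set of $R$. An up-family is a collection $\mathcal U\subset\Omega_R$ such that $X\in\mathcal U$ and $X\subset Y\subset R$ imply $Y\in\mathcal U$. Let $\mathscr U$ be the (finite) system of all up-families (including the empty one). An attractive PCA is a probability measure $\upsilon$ on $\mathscr U$; it is called an attractive CA if it is a Dirac measure. $\delta_\varnothing$ is the Dirac mass at the empty up-family. Given $\upsilon$, let $(\mathcal U_{x,t})_{(x,t)\in\mathbb Z^d\times\mathbb Z}$ be i.i.d. up-families with law $\upsilon$. Given $\omega\in\Omega$, the process $\eta^\omega$ started from $\omega$ has $\eta^\omega_x(s)=\omega_{(x,s)}$ for $s\in[-r,0)\cap\mathbb Z$, and, inductively for integers $t\ge0$ and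 $x\in\mathbb Z^d$, $\eta^\omega_x(t)=1$ if $\{(y,s)\in R:\eta^\omega_{x+y}(t+s)=1\}\in\mathcal U_{x,t}$ and $\eta^\omega_x(t)=0$ otherwise. $\mathbf 0$ and $\mathbf 1$ denote the all-$0$ and all-$1$ configurations (on the relevant index set). An invariant measure is a probability measure on $\Omega$ such that, if the initial configuration has this law and is independent of the field, then for all $t\ge0$ the configuration $(\eta_x(t+s))_{x\in\mathbb Z^d,\,s\in[-r,0)\cap\mathbb Z}$ has the same law. An attractive CA is an eroder if, for every configuration $\omega\in\Omega$ such that $\omega_{(x,s)}=0$ for only finitely many $(x,s)$, we have $\eta^\omega(t)=\mathbf 1$ for all $t$ large enough (depending on $\omega$). *)

(* Defs.v *)
From HB Require Import structures.
From mathcomp Require Import all_boot all_order all_algebra finmap.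
From mathcomp Require Import all_classical all_reals all_analysis.

Set Implicit Arguments.
Unset Strict Implicit.
Unset Printing Implicit Defensive.

Import Order.TTheory GRing.Theory Num.Theory.
Import numFieldNormedType.Exports.

Local Open Scope classical_set_scope.
Local Open Scope ring_scope.

(* Space-time points are pairs (x, t) : int * int, in dimension d = 1. *)

(* [-r, 0) `&` Z *)
Definition past (K : realType) (r : K) := {s : int | (- r <= s%:~R) && (s < 0)}.

(* R = ([-r, r] * [-r, 0)) `&` Z^2 *)
Definition nbhd (K : realType) (r : K) :=
  {z : int * int | [&& - r <= z.1%:~R, z.1%:~R <= r, - r <= z.2%:~R & z.2 < 0]}.

(* {0,1}^R is identified with the power set of R, here set (nbhd r). *)
Record upfamily (K : realType) (r : K) := Upfamily {
  upfam :> set (set (nbhd r)) ;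
  upfam_up : forall X Y : set (nbhd r), X `<=` Y -> upfam X -> upfam Y }.

Definition upfamily0 (K : realType) (r : K) : upfamily r :=
  @Upfamily K r set0 (fun X Y _ (X0 : set0 X) => X0).

Section upfamily_measurable.
Context (K : realType) (r : K).

HB.instance Definition _ := gen_eqMixin (upfamily r).
HB.instance Definition _ := gen_choiceMixin (upfamily r).
HB.instance Definition _ := isPointed.Build (upfamily r) (upfamily0 r).

(* There are finitely many up-families: the sigma-algebra is the discrete one. *)
HB.instance Definition _ := @isMeasurable.Build default_measure_display
  (upfamily r) discrete_measurable discrete_measurable0
  discrete_measurableC discrete_measurableU.

End upfamily_measurable.

(* Omega = {0,1}^(Z * ([-r, 0) `&` Z)), with the product sigma-algebra, i.e.  *)
(* the one generated by the coordinate events.                                *)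
Definition coordinate_events (K : realType) (r : K) :
    set (set (int * past r -> bool)) :=
  [set [set w | w z = true] | z in [set: int * past r]].

Definition config (K : realType) (r : K) :=
  g_sigma_algebraType (@coordinate_events K r).

HB.instance Definition _ (K : realType) (r : K) := Measurable.on (config r).

Definition config0 (K : realType) (r : K) : config r := fun=> false.
Arguments config0 {K} r.

Section process.
Context (K : realType) (r : K).
Variables (u : int * int -> upfamily r) (w : config r).

(* hist n x t is eta_x(t) for t < n; the value for t >= n is irrelevant. *)
Fixpoint hist (n : nat) (x t : int) : bool :=
  if n is m.+1 then
    if t == m%:Z then
      `[< upfam (u (x, t))
            [set z : nbhd r | hist m (x + (val z).1) (t + (val z).2)] >]
    else hist m x t
  else if insub t is Some s then w (x, s) else false.

Definition eta (x t : int) : bool := hist `|t|.+1 x t.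

Lemma hist_stable (n m : nat) (x t : int) :
  (t < n%:Z) -> (t < m%:Z) -> hist n x t = hist m x t.
Proof.
wlog nm : n m / (n <= m)%N.
  by case: (leqP n m) => [nm H tn tm|/ltnW nm H tn tm]; [|symmetry]; apply: H.
move=> tn _; elim: m nm => [|m IH]; first by rewrite leqn0 => /eqP ->.
rewrite leq_eqVlt => /predU1P[->//|]; rewrite ltnS => nm /=.
rewrite ifF; first exact: IH.
by apply: negbTE; rewrite lt_eqF// (lt_le_trans tn)// lez_nat.
Qed.

Lemma eta_past (x : int) (s : past r) : eta x (val s) = w (x, s).
Proof.
have s0 : val s < 0 by case: s => s /= /andP[].
rewrite /eta (@hist_stable _ 0)//= ?valK//.
by rewrite (lt_trans s0).
Qed.

Lemma eta_step (x : int) (t : nat) :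
  eta x t = `[< upfam (u (x, t%:Z))
    [set z : nbhd r | eta (x + (val z).1) (t%:Z + (val z).2)] >].
Proof.
rewrite {1}/eta absz_nat /= eqxx.
congr (`[< upfam _ _ >]); apply/funext => z; congr is_true.
have z0 : (val z).2 < 0 by case: z => z /= /and4P[].
by apply: hist_stable; rewrite ?gtrDl// -addn1 PoszD ltzD1 abszE ler_norm.
Qed.

Definition eta_config (t : nat) : config r :=
  fun z => eta z.1 (t%:Z + val z.2).

End process.

(* The attractive CA given by the Dirac mass at U: every U_(x,t) equals U, and *)
(* the process is deterministic.                                               *)
Definition eroder (K : realType) (r : K) (U : upfamily r) :=
  forall w : config r, finite_set [set z | w z = false] ->
    exists t0 : int, forall t : int, t0 <= t ->
      forall x : int, eta (fun=> U) w x t = true.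

Section invariant.
Context (K : realType) (r : K).
Local Open Scope ereal_scope.

Definition iid_field d (T : measurableType d) (P : probability T K)
    (F : int * int -> {RV P >-> upfamily r}) (v : probability (upfamily r) K) :=
  (forall z A, measurable A -> distribution P (F z) A = v A) /\
  (forall (J : {fset int * int}) (A : int * int -> set (upfamily r)),
    (forall z, measurable (A z)) ->
    P (\bigcap_(z in [set` J]) (F z @^-1` A z)) =
    \prod_(z <- J) P (F z @^-1` A z)).

Definition field_events d (T : measurableType d) (P : probability T K)
    (F : int * int -> {RV P >-> upfamily r}) : set (set T) :=
  <<s [set B | exists z A, measurable A /\ B = F z @^-1` A] >>.

Definition indep_of_field d (T : measurableType d) (P : probability T K)
    (W : {RV P >-> config r}) (F : int * int -> {RV P >-> upfamily r}) :=
  forall A B, measurable A -> field_events F B ->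
    P (W @^-1` A `&` B) = P (W @^-1` A) * P B.

(* Probabilities are functions on all sets, of which only the values on       *)
(* measurable sets are meaningful.                                            *)
Definition same_law (mu nu : set (config r) -> \bar K) :=
  forall A, measurable A -> mu A = nu A.

Definition invariant_measure (v : probability (upfamily r) K)
    (mu : probability (config r) K) :=
  forall d (T : measurableType d) (P : probability T K)
    (F : int * int -> {RV P >-> upfamily r}) (W : {RV P >-> config r}),
    iid_field F v -> same_law (distribution P W) mu -> indep_of_field W F ->
    forall t : nat,
      same_law (pushforward P (fun a => eta_config (F ^~ a) (W a) t)) mu.

End invariant.

Section death.
Context (K : realType) (r : K).
Variables (p : {i01 K}) (U : upfamily r).

(* p \d_U + (1 - p) \d_0, where 0 is the empty up-family *)
Definition with_death : set (upfamily r) -> \bar K :=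
  measure_add (mscale p%:num%:nng \d_U)
              (mscale (1 - p%:num)%:nng \d_(upfamily0 r)).

HB.instance Definition _ := Measure.on with_death.

Let with_death_setT : with_death setT = 1%E.
Proof.
have d1 (a : upfamily r) : \d_a [set: upfamily r] = 1%E :> \bar K.
  exact: diracT.
rewrite /with_death measure_addE.
rewrite [X in (X + _)%E = _](_ : _ = (p%:num)%:E); last first.
  by rewrite -[RHS]mule1 -(d1 U).
rewrite [X in (_ + X)%E = _](_ : _ = (1 - p%:num)%:E); last first.
  by rewrite -[RHS]mule1 -(d1 (upfamily0 r)).
by rewrite -EFinD addrC subrK.
Qed.

HB.instance Definition _ :=
  Measure_isProbability.Build _ _ _ with_death with_death_setT.

End death.

(* Main.v *)
From HB Require Import structures.
Require Import Defs.
From mathcomp Require Import all_boot all_order all_algebra finmap.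
From mathcomp Require Import zify ring lra.
From mathcomp Require Import all_classical all_reals all_analysis.

(* Sort the points (a, -b) of the neighbourhood by their velocity -a / b. If  *)
(* some element of U only has velocities smaller than those of some other     *)
(* element, then, in a suitable moving frame, any finite island of zeros      *)
(* shrinks from both ends. Otherwise there is a velocity v such that every    *)
(* element of U has velocities both <= v and >= v, and any wide enough strip  *)
(* of zeros of slope v persists forever. This dichotomy decides eroders.      *)
(* In the second case, independent blocks of deaths along a strip of slope v  *)
(* almost surely fill a section of it, after which it stays at 0, so that     *)
(* \d_0 is the only invariant measure. In the first case, the law of the      *)
(* greatest solution of the recursion on the whole of Z^2 is invariant, and a *)
(* Peierls argument shows that it is not \d_0: a zero is the base point of a  *)
(* closed contour (Toom) whose arrows increase a linear form except for a     *)
(* number of jumps of the order of the number of distinct deaths it visits.   *)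

Set Implicit Arguments.
Unset Strict Implicit.
Unset Printing Implicit Defensive.

Import Order.TTheory GRing.Theory Num.Theory.
Local Open Scope classical_set_scope.
Local Open Scope ring_scope.

(** * Shrinking islands and lasting strips *)

(** A site at zero has a zero in every element of its up-family. In the shrinking case, following
    such zeros backwards through [X1] raises the form at each step and through [X2] lowers it, so a
    late zero needs two initial zeros with very different values of the form ([shrinking_eroder]).
    In the lasting case, every element of [U] meets both closed half-planes of the form, so a one
    cannot enter a wide strip of zeros ([lasting_strip], [lasting_not_eroder]). Since
    [shrinking_or_lasting] leaves no third case, it remains to match the two cases with the
    behaviour under deaths.

    In the shrinking case with rare deaths, the limit of deeper and deeper unrollings of the
    recursion has an invariant law ([survivors_invariant]). A zero at depth [k] yields a contour
    ([unroll_contour]). Being closed, it rises no more than its jumps descend, so its length is at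
    most a constant times its number of sinks ([contour_size]); loop erasure makes the sinks
    distinct ([contour_uniq]), so that their deaths are independent. The union bound over words is
    then a geometric series, uniform in [k] ([shrinking_unroll], [shrinking_stable]).

    In the lasting case, deaths only help the strip. A one at a late time requires each of many
    disjoint blocks of the strip to contain a site that is not dead, which has exponentially small
    probability; by invariance every coordinate is almost surely zero ([lasting_coordinate],
    [lasting_extinct]). *)

Definition lin_form (a b : int) (z : int * int) : int := a * z.1 + b * z.2.

Lemma lin_formD a b (y z : int * int) :
  lin_form a b (y + z) = lin_form a b y + lin_form a b z.
Proof. by rewrite /lin_form /=; ring. Qed.

Lemma lin_formN a b (z : int * int) : lin_form a b (- z) = - lin_form a b z.
Proof. by rewrite /lin_form /=; ring. Qed.

Lemma lin_form_le a b (N : nat) (z : int * int) :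
  `|z.1| <= N%:Z -> `|z.2| <= N%:Z ->
  `|lin_form a b z| <= (`|a| + `|b|) * N%:Z.
Proof.
move=> h1 h2; rewrite /lin_form (le_trans (ler_normD _ _))// !normrM mulrDl.
by rewrite lerD// ler_wpM2l.
Qed.

Lemma finite_box (B : nat) :
  finite_set [set z : int * int | `|z.1| <= B%:Z /\ `|z.2| <= B%:Z].
Proof.
pose e (ij : nat * nat) : int * int := (ij.1%:Z - B%:Z, ij.2%:Z - B%:Z).
apply: (@sub_finite_set _ _ (e @` (`I_(B.*2.+1) `*` `I_(B.*2.+1)))); last first.
  by apply/finite_image/finite_setX; exact: finite_II.
move=> [x t] /= [xB tB].
exists (absz (x + B%:Z), absz (t + B%:Z)); first by split => /=; lia.
by rewrite /e/=; congr (_, _); lia.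
Qed.

Lemma nat_upper_bound (K : realType) (x : K) : exists N : nat, x <= N%:R.
Proof.
exists (Num.bound `|x|); rewrite (le_trans (ler_norm x))// ltW//.
exact: archi_boundP.
Qed.

Section dichotomy.
Context (K : realType) (r : K).
Implicit Types (U : upfamily r).

(* A zero not due to a death comes from a zero at a larger value of           *)
(* [lin_form a b] because of X1, and from one at a smaller value because of   *)
(* X2: islands of zeros are eaten from both sides.                            *)
Definition shrinking U (a b : int) (X1 X2 : set (nbhd r)) :=
  [/\ upfam U X1, upfam U X2, forall z, X1 z -> 1 <= lin_form a b (val z) &
      forall z, X2 z -> lin_form a b (val z) <= -1].

(** With [a > 0] the level lines are not horizontal, so a strip around one has finitely many points
    at each time. *)
Definition lasting U (a b : int) :=
  0 < a /\ forall X, upfam U X ->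
    (exists2 z, X z & 0 <= lin_form a b (val z)) /\
    (exists2 z, X z & lin_form a b (val z) <= 0).

Variable N : nat.
Hypothesis rN : r <= N%:R.

Lemma nbhd_bounds (z : nbhd r) :
  [/\ `|(val z).1| <= N%:Z, - N%:Z <= (val z).2 & (val z).2 <= -1].
Proof.
case: z => -[x t] /= /and4P[]/= h1 h2 h3 h4.
have e : N%:Z%:~R = N%:R :> K by [].
have h5 : (- N%:Z)%:~R <= x%:~R :> K.
  by rewrite mulrNz e (le_trans _ h1)// lerN2.
have h6 : x%:~R <= N%:Z%:~R :> K by rewrite e (le_trans h2).
have h7 : (- N%:Z)%:~R <= t%:~R :> K.
  by rewrite mulrNz e (le_trans _ h3)// lerN2.
rewrite !ler_int in h5 h6 h7.
by split; lia.
Qed.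

Lemma past_bounds (s : past r) : - N%:Z <= val s < 0.
Proof.
have e : N%:Z%:~R = N%:R :> K by [].
case: s => s /= /andP[h1 ->]; rewrite andbT -(ler_int K) mulrNz e.
by rewrite (le_trans _ h1)// lerN2.
Qed.

Lemma nbhd_norm2 (z : nbhd r) : `|(val z).2| <= N%:Z.
Proof. by have [] := nbhd_bounds z; lia. Qed.

Lemma finite_nbhd : finite_set [set: nbhd r].
Proof.
apply: (@sub_finite_set _ _ (val @^-1`
    [set z : int * int | `|z.1| <= N%:Z /\ `|z.2| <= N%:Z])).
  by move=> z _; have [h1 _ _] := nbhd_bounds z; have := nbhd_norm2 z.
by apply: finite_preimage; [move=> ? ? _ _; exact: val_inj|exact: finite_box].
Qed.

(* Multiplied by N!, all velocities -z.1/-z.2 are integers; v is the smallest *)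
(* maximal velocity of an element of U.                                       *)
Lemma shrinking_or_lasting U :
  (exists a b X1 X2, shrinking U a b X1 X2) \/ (exists a b, lasting U a b).
Proof.
(* If the empty set belongs to [U], shrinking holds vacuously; if [U] has no element, lasting
   does. *)
have [U0|U0] := pselect (upfam U set0).
  by left; exists 0, 0, set0, set0; split.
have [[X UX]|nU] := pselect (exists X, upfam U X); last first.
  by right; exists 1, 0; split=> // X UX; case: nU; exists X.
pose M : int := N`!%:Z; pose B : nat := (N`! * N).+1.
have M0 : 0 < M by rewrite /M ltz_nat fact_gt0.
have dvdM (z : nbhd r) : exists2 k : int, M = - (val z).2 * k & 0 < k.
  have [_ h1 h2] := nbhd_bounds z.
  have [|k Mk] := @dvdnP `|(val z).2| N`! _.
    by apply: dvdn_fact; lia.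
  by exists k%:Z; move: (fact_gt0 N); rewrite /M Mk; nia.
(* On a slow set the velocities times [M] are at most [v]. The shift by [B], which exceeds every
   scaled velocity, lets [v] be minimised over [nat]. *)
pose slow (v : int) (Y : set (nbhd r)) :=
  forall z, Y z -> 0 <= M * (val z).1 - v * (val z).2.
pose P (n : nat) := `[< exists2 Y, upfam U Y & slow (n%:Z - B%:Z) Y >].
have MN (z : nbhd r) : `|M * (val z).1| < B%:Z.
  have [h _ _] := nbhd_bounds z.
  by rewrite normrM (gtr0_norm M0) /B /M -addn1 PoszD PoszM; nia.
have exP : exists n, P n.
  exists (B + B)%N; apply/asboolP; exists X => // z _.
  by have := MN z; have [_ _ ?] := nbhd_bounds z; nia.
case: (ex_minnP exP) => n /asboolP[X1 UX1 slowX1] minn.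
pose v : int := n%:Z - B%:Z.
have fast Y : upfam U Y -> exists2 z, Y z & M * (val z).1 - v * (val z).2 <= 0.
  move=> UY; apply: contrapT => nY; case: (posnP n) => [n0|n_gt0].
    suff X10 : X1 = set0 by apply: U0; rewrite -X10.
    rewrite -subset0 => z X1z; have := slowX1 z X1z; rewrite n0.
    by have := MN z; have [_ _ ?] := nbhd_bounds z; nia.
  (* Scaled velocities are integers: if all those of [Y] are below [v], they are at most [v - 1],
     against minimality. *)
  suff /minn : P n.-1 by rewrite leqNgt prednK// leqnn.
  apply/asboolP; exists Y => // z Yz; rewrite leNgt; apply/negP => hz.
  apply: nY; exists z => //; have [k Mk k0] := dvdM z.
  have [_ _ ?] := nbhd_bounds z.
  have : k * (val z).1 + (n.-1%:Z - B%:Z) < 0 by move: hz; rewrite Mk; nia.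
  by rewrite Mk /v; nia.
have [[X2 UX2 fastX2]|nX2] := pselect
    (exists2 Y, upfam U Y & forall z, Y z -> M * (val z).1 - v * (val z).2 < 0).
  (* Scaled velocities are at most [v] on [X1] and at least [v + 1] on [X2]; the form of scaled
     velocity [v + 1/2] separates them, and doubling keeps it integral. *)
  left; exists (2 * M), (- (2 * v + 1)), X1, X2.
  split=> // z Xz; rewrite /lin_form; have [_ _ ?] := nbhd_bounds z.
    have := slowX1 z Xz; rewrite -/v; nia.
  have [k Mk k0] := dvdM z.
  have : k * (val z).1 + v < 0 by move: (fastX2 z Xz); rewrite Mk; nia.
  by rewrite Mk; nia.
right; exists M, (- v); split => // Y UY.
have [z Yz hz] := fast Y UY; split; last first.
  by exists z => //; rewrite /lin_form mulNr.
apply: contrapT => nY; apply: nX2; exists Y => // y Yy.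
rewrite ltNge; apply/negP => hy; apply: nY; exists y => //.
by rewrite /lin_form mulNr.
Qed.

Lemma eta_step_false (u : int * int -> upfamily r) (w : config r) (x : int)
    (t : nat) (X : set (nbhd r)) :
  upfam (u (x, t%:Z)) X -> eta u w x t = false ->
  exists2 z, X z & eta u w (x + (val z).1) (t%:Z + (val z).2) = false.
Proof.
move=> uX; rewrite eta_step => /asboolPn nu.
apply: contrapT => nX; apply: nu; apply: upfam_up uX => z Xz /=.
by apply: contrapT => /negP/negbTE hz; apply: nX; exists z.
Qed.

Lemma eta_past_true (u : int * int -> upfamily r) (w : config r) (x t : int) :
  - N%:Z <= t < 0 -> eta u w x t = true ->
  exists2 s : past r, val s = t & w (x, s) = true.
Proof.
move=> /andP[_ t0]; rewrite /eta (@hist_stable _ _ _ _ _ 0)/=; last by lia.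
  by case: insubP => // s _ <-; exists s.
by lia.
Qed.

End dichotomy.

Section deterministic.
Context (K : realType) (r : K).
Variable N : nat.
Hypothesis rN : r <= N%:R.
Implicit Types (U : upfamily r) (w : config r).

Lemma nbhd_past (z : nbhd r) (t : nat) : t%:Z + (val z).2 < 0 ->
  exists s : past r, val s = t%:Z + (val z).2.
Proof.
move=> t0; have tP : (- r <= (t%:Z + (val z).2)%:~R) && (t%:Z + (val z).2 < 0).
  rewrite t0 andbT; case: z t0 => z /= /and4P[_ _ h _] _.
  by rewrite (le_trans h)// ler_int lerDr.
by exists (exist (fun s : int => (- r <= s%:~R) && (s < 0)) _ tP).
Qed.

(** Each backward step to a zero in [X] gains at least 1 in the form and goes back at most [N] in
    time, so reaching the past from time [t] takes at least [t / N] steps. *)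
Lemma eta_false_chain U w a b (X : set (nbhd r)) :
  upfam U X -> (forall z, X z -> 1 <= lin_form a b (val z)) ->
  forall (t : nat) x, eta (fun=> U) w x t = false ->
  exists y (s : past r), w (y, s) = false /\
    t%:Z <= N%:Z * (lin_form a b (y, val s) - lin_form a b (x, t%:Z)).
Proof.
move=> UX hX; elim/ltn_ind => t IH x etax.
have [z Xz etaz] := @eta_step_false _ _ (fun=> U) w x t X UX etax.
have := hX z Xz; have [_ z1 z2] := nbhd_bounds rN z.
have E y : lin_form a b y - lin_form a b (x, t%:Z) =
  (lin_form a b y - lin_form a b (x + (val z).1, t%:Z + (val z).2)) +
  lin_form a b (val z).
  by rewrite -[(x + _, _)]/((x, t%:Z) + val z) lin_formD; ring.
have [t0 hz|t0 hz] := ltP (t%:Z + (val z).2) 0.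
  have [s sE] := nbhd_past t0; exists (x + (val z).1), s; split.
    by rewrite -(eta_past (fun=> U)) sE.
  by rewrite sE E subrr add0r; nia.
have [||y [s [wy ty]]] := IH (absz (t%:Z + (val z).2)%R) _ (x + (val z).1).
- by lia.
- by rewrite gez0_abs.
exists y, s; split => //; rewrite E.
rewrite gez0_abs// in ty; rewrite mulrDr.
have hN : N%:Z <= N%:Z * lin_form a b (val z) by nia.
by apply: le_trans (lerD ty hN); lia.
Qed.

(** The chains along [X1] and along [X2], the latter for the opposite form, lead from one zero at
    time [t] to initial zeros whose values differ by at least [2 t / N], while initial values are
    bounded by [B]. *)
Lemma shrinking_eroder U a b X1 X2 :
  @shrinking _ r U a b X1 X2 -> eroder U.
Proof.
move=> [UX1 UX2 hX1 hX2] w /finite_seqP[zs zsE].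
pose B := \max_(z <- zs) `|lin_form a b (z.1, val z.2)|%N.
have zB y s : w (y, s) = false -> `|lin_form a b (y, val s)| <= B%:Z.
  move=> wys; have : (y, s) \in zs.
    by have : [set z | w z = false] (y, s) by []; rewrite zsE.
  move=> zsys; rewrite -abszE lez_nat.
  exact: (@leq_bigmax_seq _ zs xpredT
    (fun z => `|lin_form a b (z.1, val z.2)|%N) _ zsys isT).
exists (N * B).+1%:Z => t ht x; apply: contrapT => /negP/negbTE.
have -> : t = `|t|%N%:Z by lia.
move=> etax.
have [y1 [s1 [w1 t1]]] := eta_false_chain UX1 hX1 etax.
have hX2' z : X2 z -> 1 <= lin_form (- a) (- b) (val z).
  by move=> /hX2; rewrite /lin_form !mulNr; lia.
have [y2 [s2 [w2 t2]]] := eta_false_chain UX2 hX2' etax.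
have := zB _ _ w1; have := zB _ _ w2; move: t1 t2 ht.
have N_ z : lin_form (- a) (- b) z = - lin_form a b z.
  by rewrite /lin_form !mulNr opprD.
by rewrite !N_; move: (lin_form a b _) (lin_form a b _) (lin_form a b _); nia.
Qed.

(* In the upper half of the strip use a point of the neighbourhood where the  *)
(* linear form is <= 0, in the lower half one where it is >= 0.               *)
Lemma lasting_strip U (u : int * int -> upfamily r) w a b (C c t0 : int) :
  lasting U a b -> (forall z, upfam (u z) `<=` upfam U) ->
  (forall z : nbhd r, `|lin_form a b (val z)| <= C) -> 0 <= t0 ->
  (forall x t, t0 - N%:Z <= t < t0 -> `|lin_form a b (x, t) - c| <= C ->
    eta u w x t = false) ->
  forall t x, t0 - N%:Z <= t -> `|lin_form a b (x, t) - c| <= C ->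
    eta u w x t = false.
Proof.
move=> [_ last] uU hC t0_ge0 base.
have H (n : nat) x t : t0 - N%:Z <= t -> t < t0 + n%:Z ->
    `|lin_form a b (x, t) - c| <= C -> eta u w x t = false.
  elim/ltn_ind: n x t => n IH x t tl tu tC.
  have [tt0|tt0] := ltP t t0; first by apply: base; rewrite // tl.
  have tE : t = `|t|%N%:Z by lia.
  apply/negbTE/negP => /[dup] etax; rewrite tE eta_step => /asboolP/uU/last.
  rewrite -tE => -[[z1 e1 h1] [z2 e2 h2]].
  have step (z : nbhd r) : `|lin_form a b ((x, t) + val z) - c| <= C ->
      eta u w (x + (val z).1) (t + (val z).2) = true -> False.
    move=> hz; have [_ h3 h4] := nbhd_bounds rN z.
    by rewrite (IH n.-1)//; lia.
  have [le0|gt0] := leP (lin_form a b (x, t)) c.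
    by apply: (step z1) => //; rewrite lin_formD; have := hC z1; lia.
  by apply: (step z2) => //; rewrite lin_formD; have := hC z2; lia.
by move=> t x tl; apply: (H (absz (t - t0)).+1) => //; lia.
Qed.

Lemma lasting_not_eroder U a b : 0 <= r -> lasting U a b -> ~ eroder U.
Proof.
move=> r0 /[dup] last [a0 _] er.
(* The factor [N.+1] gives [C >= a] even when [N] is 0, so the strip contains a lattice point at
   every time, found below by Euclidean division by [a]. *)
pose C : int := (`|a| + `|b|) * N.+1%:Z.
have hC (z : nbhd r) : `|lin_form a b (val z)| <= C.
  have [h1 _ _] := nbhd_bounds rN z.
  apply: lin_form_le; first lia.
  by have := nbhd_norm2 rN z; lia.
pose w : config r := fun z => ~~ (`|lin_form a b (z.1, val z.2)| <= C).
have finw : finite_set [set z | w z = false].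
  pose h (z : int * past r) := (z.1, val z.2).
  pose B := absz (C + `|b| * N%:Z).
  apply: (@sub_finite_set _ _ (h @^-1`
      [set z | `|z.1| <= B%:Z /\ `|z.2| <= B%:Z])); last first.
    apply: finite_preimage; last exact: finite_box.
    by move=> -[x s] [x' s'] _ _ [-> ss']; congr (_, _); exact: val_inj.
  move=> [x s] /= /negbFE; have := past_bounds rN s.
  rewrite /lin_form/h/=; move: (val s) => t tb tC.
  have btN : `|b * t| <= `|b| * N%:Z by rewrite normrM ler_wpM2l//; lia.
  have BE : B%:Z = `|a| * N.+1%:Z + `|b| * N.+1%:Z + `|b| * N%:Z.
    by rewrite /B /C abszE ger0_norm; nia.
  have tB : `|t| <= B%:Z.
    suff : N%:Z <= B%:Z by lia.
    by rewrite BE; nia.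
  have xB : `|x| <= B%:Z.
    have : `|a * x| <= B%:Z by rewrite BE; move: tC; rewrite /C mulrDl; lia.
    by rewrite normrM; nia.
  by split.
have [t0 ht0] := er w finw.
pose t : int := `|t0|.
pose x := ((- (b * t)) %/ a)%Z.
have t0t : t0 <= t by rewrite /t; lia.
suff : eta (fun=> U) w x t = false by rewrite ht0.
apply: (@lasting_strip U _ w a b C 0 0) => //.
- by move=> _.
- move=> y s; rewrite sub0r subr0 => hs hys; apply/negbTE/negP.
  case/(eta_past_true rN hs) => s' s'E.
  by rewrite /w /= s'E hys.
- by rewrite /t; lia.
- rewrite subr0 /lin_form/= /C.
  have := modz_ge0 (- (b * t)) (lt0r_neq0 a0).
  have := ltz_pmod (- (b * t)) a0.
  have := divz_eq (- (b * t)) a; rewrite -/x; nia.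
Qed.

End deterministic.

(** * Contours *)

Section contour.
Context (E : finType) (dec : E -> int * int).

(* A contour starts and ends at a given zero and is a sequence of arrows and  *)
(* of visits to sinks, marked [None]. Between consecutive visits there is one *)
(* jump, an arrow [Some (false, e)] between two points forced by the same     *)
(* zero; all the other arrows, [Some (true, e)], increase a linear form.      *)
Definition letter := option (bool * E).

Definition letter_step (c : letter) : int * int :=
  if c is Some (_, e) then dec e else 0.

Definition displacement (l : seq letter) : int * int :=
  \sum_(c <- l) letter_step c.

Fixpoint sinks (z : int * int) (l : seq letter) : seq (int * int) :=
  if l is c :: l' then
    (if c is None then cons z else id) (sinks (z + letter_step c) l')
  else [::].

(** An automaton checking that visits and jumps alternate: the state is [true] when the last of
    these was a visit. Going from [false] to [true] means that a visit comes first and last, so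
    there is one more visit than jumps. *)
Fixpoint run (b : bool) (l : seq letter) : option bool :=
  if l is c :: l' then
    match c with
    | None => if b then None else run true l'
    | Some (false, _) => if b then run false l' else None
    | Some (true, _) => run b l'
    end
  else Some b.

Definition jump (c : letter) := if c is Some (false, _) then true else false.

Definition good_letter (a b C : int) (c : letter) : bool :=
  match c with
  | None => true
  | Some (true, e) => 1 <= lin_form a b (dec e)
  | Some (false, e) => - C <= lin_form a b (dec e)
  end.

Lemma displacement_cat l1 l2 :
  displacement (l1 ++ l2) = displacement l1 + displacement l2.
Proof. by rewrite /displacement big_cat. Qed.

Lemma displacement_cons c l :
  displacement (c :: l) = letter_step c + displacement l.
Proof. by rewrite /displacement big_cons. Qed.

Lemma sinks_cat z l1 l2 :
  sinks z (l1 ++ l2) = sinks z l1 ++ sinks (z + displacement l1) l2.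
Proof.
elim: l1 z => [|c l1 IH] z /=; first by rewrite /displacement big_nil addr0.
by rewrite IH displacement_cons addrA; case: c.
Qed.

Lemma run_cat b l1 l2 : run b (l1 ++ l2) = obind (run^~ l2) (run b l1).
Proof.
elim: l1 b => [|[[[] e]|] l1 IH] b //=; rewrite ?IH//.
all: by case: b => //=; rewrite IH.
Qed.

Lemma run_count b b' l : run b l = Some b' ->
  (count (predC isSome) l + b =
   count jump l + b')%N.
Proof.
elim: l b => [|[[[] e]|] l IH] b /=; first by move=> [->].
- by move=> /IH ->.
- by case: b => // /IH; lia.
- by case: b => // /IH; lia.
Qed.

Lemma size_sinks z l : size (sinks z l) = count (predC isSome) l.
Proof. by elim: l z => [|[c|] l IH] z //=; rewrite IH. Qed.

Lemma sinks_split z l y : y \in sinks z l ->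
  exists B C, l = B ++ None :: C /\ z + displacement B = y.
Proof.
elim: l z => [//|c l IH] z /= yl.
have [[cN zy]|{}yl] : c = None /\ y = z \/ y \in sinks (z + letter_step c) l.
  by case: c yl => [c|]; [right|rewrite in_cons => /predU1P[]; [left|right]].
  by exists [::], l; rewrite cN zy /displacement big_nil addr0.
have [B [C [-> <-]]] := IH _ yl.
by exists (c :: B), C; rewrite displacement_cons addrA.
Qed.

Lemma not_uniq_sinks z l : ~~ uniq (sinks z l) ->
  exists A B C, l = A ++ None :: B ++ None :: C /\ displacement B = 0.
Proof.
elim: l z => [//|c l IH] z /= nu.
have [[cN zl]|{}nu] : c = None /\ z \in sinks z l \/
    ~~ uniq (sinks (z + letter_step c) l).
- case: c nu => [c|]/=; first by right.
  by rewrite negb_and negbK addr0 => /orP[]; [left|right].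
- have [B [C [-> zB]]] := sinks_split zl.
  by exists [::], B, C; rewrite cN; split=> //; apply: (addrI z); rewrite addr0.
have [A [B [C [-> B0]]]] := IH _ nu.
by exists (c :: A), B, C.
Qed.

Variables (good : pred letter) (dead : int * int -> Prop) (z : int * int).

Definition contour l :=
  [/\ all good l, run false l = Some true, displacement l = 0 &
      forall y, y \in sinks z l -> dead y].

(* Excising the loop between two visits to the same sink keeps the contour    *)
(* conditions.                                                                *)
Lemma contour_uniq l : contour l ->
  exists l', [/\ contour l', uniq (sinks z l') & (size l' <= size l)%N].
Proof.
have [n] := ubnP (size l); elim: n l => // n IH l ln cl.
have [ul|] := boolP (uniq (sinks z l)); first by exists l.
move=> /not_uniq_sinks[A [B [C [lE B0]]]].
have [||l' [cl' ul' sl']] := IH (A ++ None :: C).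
- by move: ln; rewrite lE !size_cat /= size_cat /=; lia.
- move: cl; rewrite lE => -[gl rl dl sl]; split.
  + move: gl; rewrite !(all_cat, cat_cons)/= all_cat /=.
    by move=> /and3P[-> _ /andP[_ ->]].
  + move: rl; rewrite !run_cat; case: (run false A) => [[]|]//=.
    by rewrite run_cat/=; case: (run true B) => [[]|].
  + move: dl; rewrite !displacement_cat !displacement_cons displacement_cat.
    by rewrite displacement_cons /= B0 !add0r.
  + move=> y ys; apply: sl; move: ys; rewrite !sinks_cat/= sinks_cat /= addr0.
    rewrite B0 !addr0 !(mem_cat, in_cons).
    by case/orP => [->//|/orP[->|->]]; rewrite !orbT.
exists l'; split => //; apply: (leq_trans sl').
by rewrite lE !size_cat /= size_cat /=; lia.
Qed.

(** The total displacement is 0, each forward arrow gains at least 1 and each jump loses at most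
    [C]. With [s] visits there are [s - 1] jumps, hence at most [C (s - 1)] forward arrows. *)
Lemma contour_size a b (C : nat) l :
  {in good, forall c, good_letter a b C%:Z c} ->
  contour l -> (size l <= C.+2 * size (sinks z l))%N.
Proof.
move=> gg [gl rl dl _].
have := run_count rl; rewrite size_sinks addn0 addn1 => sE.
pose fwd (c : letter) := if c is Some (true, _) then true else false.
have szE : (size l = count fwd l + count jump l + count (predC isSome) l)%N.
  by elim: l {gl rl dl sE} => [|[[[] e]|] l IH] //=; rewrite IH; lia.
have : (count fwd l)%:Z - C%:Z * (count jump l)%:Z <=
    lin_form a b (displacement l).
  elim: l gl {rl dl sE szE} => [|c l IH] /=.
    by rewrite /displacement big_nil /lin_form/=; lia.
  move=> /andP[/gg gc /IH]; rewrite displacement_cons lin_formD.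
  by case: c gc => [[[] e]|]; rewrite /= ?add0n ?add1n /lin_form/=; lia.
rewrite dl /lin_form/= !mulr0 addr0 szE sE.
by move: (count fwd l) (count jump l); nia.
Qed.

End contour.

(** * Contours of the unrolled recursion *)

Section unrolling.
Context (K : realType) (r : K).
Variable N : nat.
Hypothesis rN : r <= N%:R.
Variable f : int * int -> upfamily r.

(* The state at z of the process started from ones k levels of recursion      *)
(* earlier; unlike a start at a fixed time, this commutes with translations.  *)
Fixpoint unroll (k : nat) (z : int * int) : bool :=
  if k is k'.+1 then `[< upfam (f z) [set y : nbhd r | unroll k' (z + val y)] >]
  else true.

Lemma unroll_false_step k z X : upfam (f z) X -> unroll k.+1 z = false ->
  exists2 y, X y & unroll k (z + val y) = false.
Proof.
move=> fX /asboolPn nf; apply: contrapT => nX; apply: nf.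
apply: upfam_up fX => y Xy /=.
by apply: contrapT => /negP/negbTE hy; apply: nX; exists y.
Qed.

Context (E : finType) (dec : E -> int * int).
Hypothesis decP : forall d : int * int,
  `|d.1| <= (N + N)%:Z -> `|d.2| <= (N + N)%:Z -> exists e, dec e = d.

(* The contour through a zero at [z] forced by zeros at [z + z1] and [z + z2] *)
(* goes to [z + z1], jumps to [z + z2] and comes back.                        *)
Lemma unroll_contour U a b X1 X2 (C : int) k z :
  @shrinking _ r U a b X1 X2 -> (`|a| + `|b|) * (N + N)%:Z <= C ->
  unroll k z = false -> exists2 l,
    contour dec (good_letter dec a b C) (fun y => f y <> U) z l &
    (size l <= 5 ^ k)%N.
Proof.
move=> [UX1 UX2 hX1 hX2] hC; elim: k z => // k IH z zk.
have [fzU|nfzU] := pselect (f z = U); last first.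
  (* At a death the contour is a single visit. *)
  exists [:: None]; last by rewrite expn_gt0.
  split=> //=; first by rewrite /displacement big_seq1.
  by move=> y; rewrite inE => /eqP ->.
have fz1 : upfam (f z) X1 by rewrite fzU.
have fz2 : upfam (f z) X2 by rewrite fzU.
have [z1 Xz1 zk1] := unroll_false_step fz1 zk.
have [z2 Xz2 zk2] := unroll_false_step fz2 zk.
have [l1 [gl1 rl1 dl1 sl1] szl1] := IH _ zk1.
have [l2 [gl2 rl2 dl2 sl2] szl2] := IH _ zk2.
have [b11 _ _] := nbhd_bounds rN z1; have b12 := nbhd_norm2 rN z1.
have [b21 _ _] := nbhd_bounds rN z2; have b22 := nbhd_norm2 rN z2.
have NN : N%:Z <= (N + N)%:Z by rewrite lez_nat leq_addr.
have [||d dE] := decP (d := val z1); [exact: le_trans NN..|].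
have [||u uE] := decP (d := - val z2).
- by rewrite /= normrN (le_trans _ NN).
- by rewrite /= normrN (le_trans _ NN).
have J1 : `|(val z2 - val z1).1| <= (N + N)%:Z.
  by rewrite PoszD (le_trans (ler_normB _ _))// lerD.
have J2 : `|(val z2 - val z1).2| <= (N + N)%:Z.
  by rewrite PoszD (le_trans (ler_normB _ _))// lerD.
have [j jE] := decP J1 J2.
exists (Some (true, d) :: l1 ++ Some (false, j) :: l2 ++ [:: Some (true, u)]).
  split.
  - rewrite /= all_cat /= all_cat gl1 gl2 /= dE uE jE hX1//= andbT.
    apply/andP; split; last first.
      by rewrite lin_formN lerNr hX2.
    rewrite lerNl (le_trans _ (le_trans (lin_form_le a b J1 J2) hC))//.
    by rewrite -normrN ler_norm.
  - by rewrite /= run_cat rl1/= run_cat rl2.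
  - rewrite displacement_cons displacement_cat displacement_cons.
    rewrite displacement_cat displacement_cons dl1 dl2 /= dE jE uE.
    rewrite /displacement big_nil !(add0r, addr0) addrA (addrC (val z1)).
    by rewrite subrK subrr.
  - move=> y; rewrite /= sinks_cat /= sinks_cat /= cats0 mem_cat dl1 addr0.
    rewrite dE jE -addrA (addrC (val z1)) subrK.
    by move=> /orP[/sl1|/sl2].
(* Two contours and three arrows: [2 * 5 ^ k + 3] is at most [5 ^ k.+1]. *)
rewrite /= !size_cat/= size_cat/= expnS.
have : (0 < 5 ^ k)%N by rewrite expn_gt0.
by clear -szl1 szl2; lia.
Qed.

End unrolling.

(** * Independent fields of up-families *)

Section bernoulli_digits.
Context {K : realType}.
Variable p : K.
Hypothesis p01 : 0 <= p <= 1.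

(* The nth digit of x in [a, a + l[, when each interval is split in the ratio *)
(* p : 1 - p; true means left.                                                *)
Fixpoint digit (n : nat) (a l x : K) : bool :=
  if n is n'.+1 then
    if x < a + l * p then digit n' a (l * p) x
    else digit n' (a + l * p) (l * (1 - p)) x
  else x < a + l * p.

Definition digit_event n (A : nat -> pred bool) (a l : K) : set K :=
  [set x | (a <= x < a + l)%R /\ forall i, (i < n)%N -> A i (digit i a l x)].

Definition bernoulli_weight (B : pred bool) : K :=
  (B true)%:R * p + (B false)%:R * (1 - p).

Lemma digit_eventS n A a l : 0 <= l -> digit_event n.+1 A a l =
  (if A 0%N true then digit_event n (A \o S) a (l * p) else set0) `|`
  (if A 0%N false then
     digit_event n (A \o S) (a + l * p) (l * (1 - p)) else set0).
Proof.
move=> l0; case/andP: p01 => p0 p1.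
have e1 : a + l * p + l * (1 - p) = a + l by ring.
have lp : 0 <= l * p by rewrite mulr_ge0.
have lq : 0 <= l * (1 - p) by rewrite mulr_ge0// subr_ge0.
apply/seteqP; split => x.
- move=> [/andP[ax xl] H]; have := H 0%N isT => /=.
  case: (ltP x (a + l * p)) => h A0.
    left; rewrite A0; split => [|i ni]; first by rewrite ax h.
    by have := H i.+1 ni; rewrite /= h.
  right; rewrite A0; split => [|i ni]; first by rewrite h e1 xl.
  by have := H i.+1 ni; rewrite /= ltNge h.
case=> /=.
- case: ifPn => // A0 [/andP[ax xl] H]; split.
    by rewrite ax (lt_le_trans xl)// -e1 lerDl.
  by case=> [|i] ni /=; rewrite xl//; exact: H.
- case: ifPn => // A0 [/andP[ax xl] H]; split.
    by rewrite -e1 xl andbT (le_trans _ ax)// lerDl.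
  by case=> [|i] ni /=; rewrite ltNge ax //=; exact: H.
Qed.

(** The digits after the first are those of a subinterval whose length is scaled by [p] or [1 - p],
    so by induction the measure factorises: the digits are independent. *)
Lemma digit_event_measure n A a l : 0 <= l ->
  measurable (digit_event n A a l) /\
  lebesgue_measure (digit_event n A a l) =
    (l * \prod_(i < n) bernoulli_weight (A i))%:E.
Proof.
case/andP: (p01) => p0 p1.
elim: n A a l => [|n IH] A a l l0.
  have -> : digit_event 0 A a l = `[a, a + l[%classic.
    by apply/seteqP; split => x /=; rewrite in_itv/=; [case|].
  split; first exact: measurable_itv.
  rewrite lebesgue_measure_itv/= lte_fin ltrDl -EFinD addrAC subrr add0r.
  by rewrite big_ord0 mulr1; case: ltgtP l0 => // <-.
have lp : 0 <= l * p by rewrite mulr_ge0.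
have lq : 0 <= l * (1 - p) by rewrite mulr_ge0// subr_ge0.
have [m1 v1] := IH (A \o S) a _ lp.
have [m2 v2] := IH (A \o S) (a + l * p) _ lq.
have m1' : measurable (if A 0%N true then
     digit_event n (A \o S) a (l * p) else set0).
  by case: ifP.
have m2' : measurable (if A 0%N false then
     digit_event n (A \o S) (a + l * p) (l * (1 - p)) else set0).
  by case: ifP.
rewrite digit_eventS//; split; first exact: measurableU.
rewrite measureU//=; last first.
  rewrite -subset0 => x [].
  do 2 (case: ifP => // _); move=> [/andP[_ h] _] [/andP[+ _] _].
  by rewrite leNgt h.
rewrite big_ord_recl [bernoulli_weight (A ord0)]/bernoulli_weight /=.
rewrite (fun_if lebesgue_measure) (fun_if lebesgue_measure) measure0 v1 v2.
set Q := \prod_(i < n) _.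
case: (A 0%N true); case: (A 0%N false); rewrite /= -?EFinD; congr EFin.
all: ring.
Qed.

Definition unit_measure :=
  mrestr (@lebesgue_measure K) (measurable_itv `[0, 1[).

HB.instance Definition _ := Measure.on unit_measure.

Let unit_measure_setT : unit_measure setT = 1%E.
Proof.
rewrite /unit_measure/mrestr setTI lebesgue_measure_itv/= lte_fin ltr01.
by rewrite oppr0 adde0.
Qed.

HB.instance Definition _ :=
  Measure_isProbability.Build _ _ _ unit_measure unit_measure_setT.

End bernoulli_digits.

Section field.
Context (K : realType) (r : K).

(* Generating by cylinders rather than by coordinate events gives a pi-system.*)
Definition cylinders : set (set (int * int -> upfamily r)) :=
  [set B | exists (J : {fset int * int}) (A : int * int -> set (upfamily r)),
     B = [set f | forall z, z \in J -> A z (f z)]].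

Definition field := g_sigma_algebraType cylinders.

HB.instance Definition _ := Measurable.on field.

Definition cylinder (J : {fset int * int}) (A : int * int -> set (upfamily r)) :
  set field := [set f | forall z, z \in J -> A z (f z)].

Lemma measurable_cylinder J A : measurable (cylinder J A).
Proof. by apply: sub_sigma_algebra; exists J, A. Qed.

Lemma setI_closed_cylinders : setI_closed cylinders.
Proof.
move=> _ _ [J1 [A1 ->]] [J2 [A2 ->]].
pose A z := [set V | (z \in J1 -> A1 z V) /\ (z \in J2 -> A2 z V)].
exists (J1 `|` J2)%fset, A; apply/seteqP; split => f /=.
- by move=> [h1 h2] z _; split => [/h1|/h2].
- move=> h; split => z zJ.
    have /h[+ _] : z \in (J1 `|` J2)%fset by rewrite in_fsetU zJ.
    exact.
  have /h[_ +] : z \in (J1 `|` J2)%fset by rewrite in_fsetU zJ orbT.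
  exact.
Qed.

Lemma measurable_coord z (A : set (upfamily r)) :
  measurable [set f : field | A (f z)].
Proof.
rewrite (_ : [set _ | _] = cylinder [fset z]%fset (fun=> A)).
  exact: measurable_cylinder.
apply/seteqP; split => f /=; first by move=> Af y; rewrite in_fset1 => /eqP ->.
by apply; rewrite in_fset1.
Qed.

Lemma measurable_field d (T : measurableType d) (F : T -> field) :
  (forall z A, measurable [set a | A (F a z)]) -> measurable_fun setT F.
Proof.
move=> mF; apply: (@measurability _ _ _ field _ _ cylinders) => //.
move=> _ [_ [J [A ->]] <-]; rewrite setTI.
rewrite (_ : _ @^-1` _ = \bigcap_(z in [set` J]) [set a | A z (F a z)])//.
by apply: fin_bigcap_measurable => //; exact: finite_fset.
Qed.

Lemma measurable_config d (T : measurableType d) (W : T -> config r) :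
  (forall z, measurable [set a | W a z = true]) -> measurable_fun setT W.
Proof.
move=> mW.
apply: (@measurability _ _ _ (config r) _ _ (@coordinate_events K r)) => //.
by move=> _ [_ [z _ <-] <-]; rewrite setTI; exact: mW.
Qed.

Lemma cylinder_unique (m1 m2 : {measure set field -> \bar K}) :
  (m1 setT < +oo)%E ->
  (forall J A, m1 (cylinder J A) = m2 (cylinder J A)) ->
  forall B, measurable B -> m1 B = m2 B.
Proof.
move=> m1oo m12 B mB.
apply: (@measure_unique _ K field cylinders (fun=> setT)) => //.
- exact: setI_closed_cylinders.
- move=> _; exists fset0, (fun=> setT).
  by apply/seteqP; split.
- by rewrite bigcup_const.
- by move=> _ [J [A ->]]; exact: m12.
Qed.

End field.

Section iid.
Context (K : realType) (r : K).

Lemma with_death_itv (p : {i01 K}) : 0 <= p%:num <= 1.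
Proof. by apply/andP; split. Qed.

Section digit_field.
Variables (p : {i01 K}) (U : upfamily r).

Definition pick_family (b : bool) : upfamily r := if b then U else upfamily0 r.

Lemma with_deathE (A : set (upfamily r)) :
  with_death p U A =
  (bernoulli_weight p%:num (fun b => pick_family b \in A))%:E.
Proof.
have -> : with_death p U A = ((p%:num)%:E * (\d_U A : \bar K) +
    (1 - p%:num)%:E * (\d_(upfamily0 r) A : \bar K))%E.
  by rewrite /with_death measure_addE.
rewrite !diracE -!EFinM -EFinD.
by congr EFin; rewrite /bernoulli_weight; ring.
Qed.

(** One uniform variable drives the whole field: the digit numbered by the code of a site decides
    whether the site dies. *)
Definition digit_field (x : measurableTypeR K) : field r :=
  fun z => pick_family (digit p%:num (choice.pickle z) 0 1 x).

Lemma digit_fieldP (J : {fset int * int}) (A : int * int -> set (upfamily r)) :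
  let B := [set x | forall z, z \in J -> A z (digit_field x z)] in
  lebesgue_measure (`[0%R, 1%R[ `&` B) =
  (\prod_(z <- J) with_death p U (A z))%E.
Proof.
move=> B.
pose n := (\max_(z <- J) choice.pickle z).+1.
have Jn z : z \in J -> (choice.pickle z < n)%N.
  move=> zJ; rewrite ltnS.
  exact: (@leq_bigmax_seq _ (enum_fset J) xpredT choice.pickle z zJ isT).
clearbody n.
(* Digits that encode no site of [J] are left free; their weight is [p + (1 - p) = 1]. *)
pose D (i : nat) : pred bool := fun b =>
  if choice.pickle_inv i is Some z then
    (z \in J) ==> (pick_family b \in A z) else true.
have -> : `[0%R, 1%R[ `&` B = digit_event p%:num n D 0 1.
  apply/seteqP; split => x /=.
    rewrite in_itv/= => -[x01 Bx]; split=> [|i ni]; first by rewrite add0r.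
    rewrite /D; have := @choice.pickle_invK (int * int)%type i.
    case: (choice.pickle_inv i) => [z <-|//]; apply/implyP => zJ.
    by rewrite inE; exact: Bx.
  rewrite in_itv/= => -[]; rewrite add0r => x01 H; split => // z zJ.
  by have := H _ (Jn _ zJ); rewrite /D choice.pickleK_inv zJ /= inE.
have [_ ->] := digit_event_measure (with_death_itv p) n D 0 ler01.
rewrite mul1r.
rewrite (eq_bigr (fun z =>
  (bernoulli_weight p%:num (fun b => pick_family b \in A z))%:E)); last first.
  by move=> z _; exact: with_deathE.
rewrite prodEFin; congr EFin.
rewrite -(big_mkord xpredT (fun i => bernoulli_weight p%:num (D i))).
rewrite /index_iota subn0 (bigID (mem (map choice.pickle J)))/=.
rewrite [X in _ * X]big1 ?mulr1; last first.
  move=> i iJ; rewrite /D; have := @choice.pickle_invK (int * int)%type i.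
  case: (choice.pickle_inv i) iJ => [z /= + zi|].
    rewrite -zi mem_map; last exact: pcan_inj (@choice.pickleK_inv _).
    move=> /negbTE ->; rewrite /bernoulli_weight/=; ring.
  by move=> _ _; rewrite /bernoulli_weight/=; ring.
rewrite -big_filter (perm_big (map choice.pickle J)); last first.
  apply: uniq_perm => [||i].
  - by rewrite filter_uniq// iota_uniq.
  - by rewrite map_inj_uniq ?fset_uniq.
  - rewrite mem_filter mem_iota add0n leq0n /=; apply/andb_idr.
    by move=> /mapP[z /Jn + ->].
rewrite big_map; apply: eq_big_seq => z zJ.
by rewrite /D /bernoulli_weight choice.pickleK_inv zJ.
Qed.

End digit_field.
End iid.

(** * Joint law of initial configuration and field; measurability of the process *)

Section field_law.
Context (K : realType) (r : K).

Definition cylinder_law (nu : set (field r) -> \bar K)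
    (v : set (upfamily r) -> \bar K) :=
  forall J A, nu (cylinder J A) = (\prod_(z <- J) v (A z))%E.

Section iid.
Context d (T : measurableType d) (P : probability T K).
Variables (F : int * int -> {RV P >-> upfamily r}).
Variable v : probability (upfamily r) K.

Definition field_of (a : T) : field r := fun z => F z a.

Lemma measurable_field_of : measurable_fun setT field_of.
Proof.
apply: measurable_field => z A.
by rewrite -[X in measurable X]setTI; exact: (measurable_funPT (F z)).
Qed.

Lemma iid_cylinder_law : iid_field F v ->
  cylinder_law (pushforward P field_of) v.
Proof.
move=> [Fv Find] J A.
transitivity (P (\bigcap_(z in [set` J]) (F z @^-1` A z))) => //.
by rewrite Find//; apply: eq_bigr => z _; rewrite -(Fv z).
Qed.

Lemma field_events_field_of B :
  measurable B -> field_events F (field_of @^-1` B).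
Proof.
pose G := [set B | exists z A, measurable A /\ B = F z @^-1` A].
have : measurable_fun setT (field_of : g_sigma_algebraType G -> field r).
  apply: measurable_field => z A; apply: sub_sigma_algebra.
  by exists z, A.
by move=> mF mB; have := mF measurableT _ mB; rewrite setTI.
Qed.

End iid.

(** Invariance quantifies over all probability spaces; this transfers any of them to the product of
    the two laws, by uniqueness of a measure with given values on rectangles. *)
Lemma joint_law d (T : measurableType d) (P : probability T K)
    (F : int * int -> {RV P >-> upfamily r}) (W : {RV P >-> config r})
    (v : probability (upfamily r) K) (mu : probability (config r) K)
    (nu : probability (field r) K) :
  iid_field F v -> same_law (distribution P W) mu -> indep_of_field W F ->
  cylinder_law nu v ->
  forall B, measurable B ->
    P [set a | B (W a, field_of F a)] = (mu \x nu)%E B.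
Proof.
move=> Fv Wmu WF nuv B mB.
pose WFf a : config r * field r := (W a, field_of F a).
have mWF : measurable_fun setT WFf.
  by apply: measurable_fun_pair => //; exact: measurable_field_of.
pose Fm := mfun_Sub (mem_set (measurable_field_of F) : field_of F \in mfun).
pose WFm := mfun_Sub (mem_set mWF : WFf \in mfun).
have FnuE C : measurable C -> P (field_of F @^-1` C) = nu C.
  apply: (@cylinder_unique _ _ (distribution P Fm) nu) => [|J A].
    by rewrite (le_lt_trans (probability_le1 _ _))// ltry.
  exact: etrans (iid_cylinder_law Fv J A) (esym (nuv J A)).
transitivity (distribution P WFm B) => //.
apply/esym; apply: product_measure_unique => // A C mA mC.
transitivity (distribution P W A * P (field_of F @^-1` C))%E.
  exact: WF mA (field_events_field_of mC).
by congr (_ * _)%E; [exact: Wmu|exact: FnuE].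
Qed.

(** The neighbourhood is finite, so the event splits according to the pattern seen there, encoded as
    a mask of an enumeration of the neighbourhood. *)
Lemma measurable_upfam_step d (T : measurableType d) (V : T -> upfamily r)
    (h : nbhd r -> T -> bool) :
  (forall A, measurable [set a | A (V a)]) ->
  (forall y, measurable [set a | h y a]) ->
  measurable [set a | upfam (V a) [set y | h y a]].
Proof.
move=> mV mh; have [N rN] := nat_upper_bound r.
have /finite_seqP[s sE] := finite_nbhd rN.
pose X (m : bitseq) : set (nbhd r) := [set y | y \in mask m s].
have mX m : measurable
    (\bigcap_(y in [set: nbhd r]) [set a | (y \in mask m s) = h y a]).
  rewrite sE; apply: fin_bigcap_measurable => [|y _]; first exact: finite_seq.
  case: (y \in mask m s).
    rewrite (_ : [set _ | _] = [set a | h y a])//.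
    by apply/seteqP; split=> a /=; [move=> <-|move=> ->].
  rewrite (_ : [set _ | _] = ~` [set a | h y a]); first exact: measurableC.
  by apply/seteqP; split=> a /=; [move=> <-|move=> /negP/negbTE ->].
rewrite (_ : [set a | _] = \bigcup_(m in [set: bitseq])
  ([set a | upfam (V a) (X m)] `&`
   \bigcap_(y in [set: nbhd r]) [set a | (y \in mask m s) = h y a])).
  apply: countable_bigcupT_measurable => // m; apply: measurableI => //.
  exact: (mV [set W | upfam W (X m)]).
have memX a m : (forall y, (y \in mask m s) = h y a) -> [set y | h y a] = X m.
  by move=> e; apply/funext => y; rewrite /X/= e.
apply/seteqP; split => a /=; last first.
  by move=> [m _ [Va e]]; rewrite (memX a m)// => y; exact: e.
move=> Va; exists (map (h^~ a) s) => //.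
have e y : (y \in mask [seq h y a | y <- s] s) = h y a.
  rewrite -filter_mask mem_filter andbC.
  suff -> : y \in s by [].
  by have : [set: nbhd r] y by []; rewrite sE.
by split; [move: Va; rewrite (memX a _ e)|move=> y _; exact: e].
Qed.

Lemma measurable_eta (x t : int) :
  measurable [set wf : config r * field r | eta wf.2 wf.1 x t].
Proof.
have past y s : s < 0 ->
    measurable [set wf : config r * field r | eta wf.2 wf.1 y s].
  move=> s0.
  case: (insubP {: past r} s) => [s' _ ss'|ns].
    rewrite (_ : [set _ | _] = fst @^-1` [set w : config r | w (y, s') = true]).
      rewrite -[X in measurable X]setTI; apply: measurable_fst => //.
      by apply: sub_sigma_algebra; exists (y, s').
    by apply/seteqP; split => -[w f] /=; rewrite -ss' eta_past.
  rewrite (_ : [set _ | _] = set0)//; apply/seteqP; split => -[w f] //=.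
  by rewrite /eta (@hist_stable _ _ _ _ _ 0)/= ?insubN//; lia.
have [t0|t0] := ltP t 0; first exact: past.
have -> : t = `|t|%N%:Z by lia.
move: `|t|%N => {t0} {}t; elim/ltn_ind: t x => t IH x.
under eq_set do rewrite eta_step asboolE.
apply: (@measurable_upfam_step _ (config r * field r)%type
  (fun wf => wf.2 (x, t%:Z))
  (fun y wf => eta wf.2 wf.1 (x + (val y).1) (t%:Z + (val y).2))) => [A|y].
  rewrite (_ : [set _ | _] = snd @^-1` [set f : field r | A (f (x, t%:Z))])//.
  rewrite -[X in measurable X]setTI; apply: measurable_snd => //.
  exact: measurable_coord.
have [t0|t0] := ltP (t%:Z + (val y).2) 0; first exact: past.
rewrite -(gez0_abs t0); apply: IH.
have [N rN] := nat_upper_bound r.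
by have [_ _ ?] := nbhd_bounds rN y; lia.
Qed.

Lemma measurable_eta_config (t : nat) :
  measurable_fun setT (fun wf : config r * field r => eta_config wf.2 wf.1 t).
Proof. by apply: measurable_config => z; exact: measurable_eta. Qed.

End field_law.

(** * The maximal invariant measure *)

Section stationary.
Context (K : realType) (r : K).
Implicit Types f : field r.

Lemma unrollS f k z : unroll f k.+1 z -> unroll f k z.
Proof.
elim: k z => // k IH z /asboolP H; apply/asboolP; apply: upfam_up H => y.
exact: IH.
Qed.

Lemma unroll_le f k k' z : (k <= k')%N -> unroll f k' z -> unroll f k z.
Proof.
move=> /subnK <-; elim: (k' - k)%N => // n IH.
by rewrite addSn => /unrollS.
Qed.

Lemma eq_unroll f1 f2 k (z : int * int) :
  (forall y : int * int, y.2 <= z.2 -> f1 y = f2 y) ->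
  unroll f1 k z = unroll f2 k z.
Proof.
elim: k z => //= k IH z f12; rewrite f12//; congr (`[< upfam _ _ >]).
apply/funext => y; congr is_true; apply: IH => x xy; apply: f12.
by rewrite (le_trans xy)//= gerDl; case: y {xy} => y /= /and4P[_ _ _ /ltW].
Qed.

Definition survives f (z : int * int) : bool := `[< forall k, unroll f k z >].

(** A compactness argument: the unrollings decrease with depth and the neighbourhood is finite, so
    at some common depth all neighbours that do not survive are already at zero. *)
Lemma survives_step f z :
  survives f z = `[< upfam (f z) [set y : nbhd r | survives f (z + val y)] >].
Proof.
apply/asboolP/asboolP => H.
  have [N rN] := nat_upper_bound r.
  have /finite_seqP[s sE] := finite_nbhd rN.
  have [k kP] : exists k, forall y, y \in s ->
      unroll f k (z + val y) -> survives f (z + val y).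
    elim: s {sE} => [|x s [k kP]]; first by exists 0%N.
    have [sx|/asboolPn/existsNP[k' nk']] := boolP (survives f (z + val x)).
      exists k => y; rewrite in_cons => /predU1P[->//|]; exact: kP.
    exists (maxn k k') => y; rewrite in_cons => /predU1P[->|ys] uy.
      by case: nk'; apply: unroll_le uy; rewrite leq_maxr.
    by apply: kP => //; apply: unroll_le uy; rewrite leq_maxl.
  have /asboolP := H k.+1; apply: upfam_up => y; apply: kP.
  by have : [set: nbhd r] y by []; rewrite sE.
case=> // k; apply/asboolP; apply: upfam_up H => y /asboolP; exact.
Qed.

Lemma eq_survives f1 f2 (z : int * int) :
  (forall y : int * int, y.2 <= z.2 -> f1 y = f2 y) ->
  survives f1 z = survives f2 z.
Proof.
move=> f12; congr (`[< _ >]); apply/eq_forall => k.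
by rewrite (eq_unroll _ f12).
Qed.

Definition survivors (t : int) f : config r :=
  fun z => survives f (z.1, t + val z.2).

(* The past of the first field determines the initial configuration, which is *)
(* independent of the second field.                                           *)
Definition merge (ff : field r * field r) : field r :=
  fun z => if z.2 < 0 then ff.1 z else ff.2 z.

(** Both sides obey the same recursion driven by [f2] from time 0 on, and agree at negative times,
    where survival depends on [f1] only. *)
Lemma eta_merge f1 f2 t :
  eta_config f2 (survivors 0 f1) t = survivors t%:Z (merge (f1, f2)).
Proof.
suff H : forall x s, s < 0 \/ 0 <= s -> - r <= s%:~R ->
    eta f2 (survivors 0 f1) x s = survives (merge (f1, f2)) (x, s).
  apply/funext => -[x s]; apply: H; first by case: ltP; [left|right].
  have /andP[h _] : (- r <= (val s)%:~R) && (val s < 0) by case: s.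
  by apply: (le_trans h); rewrite ler_int lerDr.
have past x s : s < 0 -> - r <= s%:~R ->
    eta f2 (survivors 0 f1) x s = survives (merge (f1, f2)) (x, s).
  move=> s0 rs; have sP : (- r <= s%:~R) && (s < 0) by rewrite rs s0.
  pose s' : past r := exist (fun s : int => (- r <= s%:~R) && (s < 0)) s sP.
  have -> : s = val s' by [].
  rewrite eta_past /survivors/= add0r; apply: eq_survives => y /= ys.
  by rewrite /merge (le_lt_trans ys s0).
move=> x s [|s0] rs; first exact: past.
rewrite -(gez0_abs s0); move: `|s|%N => {s0 rs} {}s.
elim/ltn_ind: s x => s IH x.
rewrite eta_step survives_step {1}/merge /=; congr (`[< upfam _ _ >]).
apply/funext => y; congr is_true.
have yb : - r <= (s%:Z + (val y).2)%:~R /\ (val y).2 < 0.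
  case: y => y /= /and4P[_ _ h ->]; split=> //; apply: (le_trans h).
  by rewrite ler_int lerDr.
have [t0|t0] := ltP (s%:Z + (val y).2) 0; first by apply: past => //; case: yb.
rewrite -[(x, s%:Z) + _]/(x + (val y).1, s%:Z + (val y).2) -(gez0_abs t0).
by apply: IH; case: yb; lia.
Qed.

Definition shift (t : int) f : field r := fun z => f (z.1, z.2 + t).

Lemma unroll_shift t f k (z : int * int) :
  unroll (shift t f) k z = unroll f k (z.1, z.2 + t).
Proof.
elim: k z => //= k IH z; congr (`[< upfam _ _ >]); apply/funext => y.
congr is_true; rewrite IH /=; congr (unroll f k (_, _)); exact: addrAC.
Qed.

Lemma survivors_shift t f : survivors t f = survivors 0 (shift t f).
Proof.
apply/funext => z; rewrite /survivors /survives; congr (`[< _ >]).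
by apply: eq_forall => k; rewrite unroll_shift /= add0r addrC.
Qed.

Lemma measurable_unroll k z : measurable [set f : field r | unroll f k z].
Proof.
elim: k z => /= [|k IH] z.
  by rewrite (_ : [set _ | _] = setT)//; exact/seteqP.
under eq_set do rewrite asboolE.
apply: (@measurable_upfam_step _ _ _ (field r) (fun f => f z)
  (fun y f => unroll f k (z + val y))) => [A|y]; first exact: measurable_coord.
exact: IH.
Qed.

Lemma measurable_survives z : measurable [set f : field r | survives f z].
Proof.
rewrite (_ : [set _ | _] = \bigcap_k [set f : field r | unroll f k z]).
  by apply: bigcapT_measurable => k; exact: measurable_unroll.
apply/seteqP; split => f /= => [/asboolP H k _|H]; first exact: H.
by apply/asboolP => k; exact: H.
Qed.

Lemma measurable_survivors t : measurable_fun setT (survivors t).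
Proof. by apply: measurable_config => z; exact: measurable_survives. Qed.

Lemma measurable_merge : measurable_fun setT merge.
Proof.
apply: measurable_field => z A; rewrite /merge; case: (z.2 < 0).
  rewrite -[X in measurable X]setTI.
  exact: (@measurable_fst _ _ (field r) (field r) measurableT _
    (measurable_coord z A)).
rewrite -[X in measurable X]setTI.
exact: (@measurable_snd _ _ (field r) (field r) measurableT _
    (measurable_coord z A)).
Qed.

Lemma measurable_shift t : measurable_fun setT (shift t).
Proof. by apply: measurable_field => z A; exact: measurable_coord. Qed.

HB.instance Definition _ t :=
  isMeasurableFun.Build _ _ _ _ (survivors t) (measurable_survivors t).
HB.instance Definition _ :=
  isMeasurableFun.Build _ _ _ _ merge measurable_merge.
HB.instance Definition _ t :=
  isMeasurableFun.Build _ _ _ _ (shift t) (measurable_shift t).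

Variables (v : probability (upfamily r) K) (nu : probability (field r) K).
Hypothesis nuv : cylinder_law nu v.

Lemma shift_law t B : measurable B -> nu (shift t @^-1` B) = nu B.
Proof.
apply: (@cylinder_unique _ _ (distribution nu (shift t)) nu) => [|J A].
  by rewrite (le_lt_trans (probability_le1 _ _))// ltry.
pose s (z : int * int) := (z.1, z.2 + t).
pose s' (z : int * int) := (z.1, z.2 - t).
have sK : cancel s s' by move=> [x y]; rewrite /s/s'/= addrK.
transitivity (nu (cylinder [fset s z | z in J]%fset (A \o s'))).
  congr (nu _); apply/seteqP; split => f /= H z.
    by move=> /imfsetP[/= y yJ ->]; rewrite /= sK; exact: H.
  by move=> zJ; have := H (s z) (in_imfset _ _ zJ); rewrite /= sK.
rewrite nuv big_imfset/=; last by move=> x y _ _ xy; apply: (can_inj sK).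
by apply: etrans (esym (nuv J A)); apply: eq_bigr => z _; rewrite sK.
Qed.

(** Each site is read from exactly one of the two independent fields, so cylinder probabilities are
    unchanged. *)
Lemma merge_law B : measurable B -> (nu \x nu)%E (merge @^-1` B) = nu B.
Proof.
apply: (@cylinder_unique _ _ (distribution (nu \x nu)%E merge) nu) => [|J A].
  by rewrite (le_lt_trans (probability_le1 _ _))// ltry.
pose A1 (z : int * int) := if z.2 < 0 then A z else setT.
pose A2 (z : int * int) := if z.2 < 0 then setT else A z.
transitivity ((nu \x nu)%E (cylinder J A1 `*` cylinder J A2)).
  congr ((nu \x nu)%E _); apply/seteqP; split => -[f1 f2] /=.
    by move=> H; split=> z /H; rewrite /A1 /A2 /merge; case: ifP.
  move=> [H1 H2] z zJ; have := H1 z zJ; have := H2 z zJ.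
    by rewrite /A1 /A2 /merge; case: ifP.
rewrite product_measure1E; [|exact: measurable_cylinder..].
apply: etrans (esym (nuv J A)).
transitivity ((\prod_(z <- J) v (A1 z)) * (\prod_(z <- J) v (A2 z)))%E.
  by congr (_ * _)%E; exact: nuv.
rewrite -big_split.
apply: eq_bigr => z _ /=.
by rewrite /A1 /A2; case: ifP => _; rewrite probability_setT ?mule1 ?mul1e.
Qed.

(** Running survivors with a fresh field gives the survivors at time [t] of the merged field, which
    again has law [nu]; translating time by [t] returns to the survivors at time 0. *)
Lemma survivors_invariant : invariant_measure v (distribution nu (survivors 0)).
Proof.
move=> d T P F W Fv Wmu WF t A mA.
pose mu : probability (config r) K := distribution nu (survivors 0).
pose E : set (config r * field r) := [set wf | A (eta_config wf.2 wf.1 t)].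
have mE : measurable E.
  by have := @measurable_eta_config K r t measurableT _ mA; rewrite setTI.
rewrite /pushforward; transitivity ((mu \x nu)%E E).
  exact: (joint_law Fv Wmu WF nuv mE).
pose G (ff : field r * field r) := (survivors 0 ff.1, ff.2).
have mG : measurable_fun setT G.
  apply: measurable_fun_pair => //.
  exact: (measurableT_comp (measurable_survivors 0) measurable_fst).
pose Gm := mfun_Sub (mem_set mG : G \in mfun).
transitivity (distribution (nu \x nu)%E Gm E).
  apply: product_measure_unique => // B C mB mC.
  transitivity ((nu \x nu)%E ((survivors 0 @^-1` B) `*` C)) => //.
  rewrite product_measure1E//.
  by have := measurable_survivors 0 measurableT mB; rewrite setTI.
transitivity ((nu \x nu)%E (merge @^-1` (survivors t @^-1` A))).
  congr ((nu \x nu)%E _); apply/funext => -[f1 f2].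
  by rewrite /preimage /E /G /= eta_merge.
have mS s : measurable (survivors s @^-1` A).
  by have := measurable_survivors s measurableT mA; rewrite setTI.
rewrite merge_law//; transitivity (nu (shift t @^-1` (survivors 0 @^-1` A))).
  by congr (nu _); apply/funext => f; rewrite /preimage/= survivors_shift.
by rewrite shift_law.
Qed.

End stationary.

(** * Peierls bound *)

Section field_measure.
Context (K : realType) (r : K).
Variables (p : {i01 K}) (U : upfamily r).

Lemma measurable_digit (q : K) n a l :
  measurable [set x : measurableTypeR K | digit q n a l x].
Proof.
have mlt m : measurable [set x : measurableTypeR K | x < m].
  rewrite (_ : [set _ | _] = `]-oo, m[%classic); first exact: measurable_itv.
  by apply/seteqP; split => x /=; rewrite in_itv.
elim: n a l => [|n IH] a l; first exact: mlt.
rewrite (_ : [set _ | _] =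
  ([set x | x < a + l * q] `&` [set x | digit q n a (l * q) x]) `|`
  (~` [set x | x < a + l * q] `&`
     [set x | digit q n (a + l * q) (l * (1 - q)) x])).
  by apply: measurableU; apply: measurableI => //; exact: measurableC.
apply/seteqP; split => x /=; case: ifP => h.
- by left.
- by right; split => //; move: h => /negbT/negP.
- by case=> -[].
- by case=> -[].
Qed.

Lemma measurable_digit_field :
  measurable_fun setT (digit_field p U).
Proof.
apply: measurable_field => z A.
pose D := [set x : measurableTypeR K | digit p%:num (choice.pickle z) 0 1 x].
have mD : measurable D by exact: measurable_digit.
rewrite (_ : [set _ | _] = ([set x | A U] `&` D) `|`
   ([set x | A (upfamily0 r)] `&` ~` D)).
  apply: measurableU; apply: measurableI.
  - have [AU|AU] := pselect (A U).
      by rewrite (_ : [set _ | _] = setT)//; apply/seteqP; split.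
    by rewrite (_ : [set _ | _] = set0)//; apply/seteqP; split.
  - by [].
  - have [AU|AU] := pselect (A (upfamily0 r)).
      by rewrite (_ : [set _ | _] = setT)//; apply/seteqP; split.
    by rewrite (_ : [set _ | _] = set0)//; apply/seteqP; split.
  - exact: measurableC.
apply/seteqP; split => x; rewrite /digit_field /D /pick_family /=.
  by case: ifP => h Ax; [left|right; split => //; apply/negP; rewrite h].
by move=> [[Ax ->]//|[Ax /negP/negbTE ->]].
Qed.

HB.instance Definition _ :=
  isMeasurableFun.Build _ _ _ _ (digit_field p U) measurable_digit_field.

Definition field_prob : probability (field r) K :=
  distribution (@unit_measure K)
    (digit_field p U).

Lemma field_prob_law : cylinder_law field_prob (with_death p U).
Proof.
by move=> J A; rewrite -(digit_fieldP p U J A) setIC.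
Qed.

End field_measure.

Section peierls.
Context (K : realType) (r : K).

Lemma measure_bigsetU_seq_le d (T : measurableType d)
    (m : {measure set T -> \bar K}) (I : Type) (s : seq I) (B : I -> set T) :
  (forall i, measurable (B i)) ->
  (m (\big[setU/set0]_(i <- s) B i) <= \sum_(i <- s) m (B i))%E.
Proof.
move=> mB; elim: s => [|i s IH]; first by rewrite !big_nil measure0.
rewrite !big_cons (le_trans (measureU2 _ _ _))//; last exact: leeD.
by apply: bigsetU_measurable.
Qed.

Lemma sum_quarter (M : nat) :
  \sum_(n <- iota 1 M) (4^-1 : K) ^+ n <= 3^-1.
Proof.
suff -> : \sum_(n <- iota 1 M) (4^-1 : K) ^+ n = (1 - 4^-1 ^+ M) / 3.
  by rewrite ler_pdivrMr// mulVf// gerBl exprn_ge0// invr_ge0.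
elim: M => [|M IH]; first by rewrite big_nil expr0 subrr mul0r.
have -> : iota 1 M.+1 = iota 1 M ++ [:: M.+1].
  by rewrite -[in LHS](addn1 M) iotaD add1n.
rewrite big_cat IH /= big_seq1 exprS.
by field.
Qed.

Variables (p : {i01 K}) (U : upfamily r) (nu : probability (field r) K).
Hypothesis nuU : cylinder_law nu (with_death p U).

Lemma dead_prob (s : seq (int * int)) : uniq s ->
  (nu [set f | forall y, y \in s -> f y <> U] <=
     ((1 - p%:num) ^+ size s)%:E)%E.
Proof.
move=> us; pose J := [fset y in s]%fset.
rewrite (_ : [set _ | _] = cylinder J (fun=> [set V | V <> U])); last first.
  by apply/seteqP; split => f /= H y yJ; apply: H; move: yJ; rewrite in_fset.
rewrite nuU.
pose w := bernoulli_weight p%:num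
  (fun b => pick_family U b \in [set V | V <> U]).
rewrite (eq_bigr (fun=> w%:E)); last by move=> z _; exact: with_deathE.
rewrite prodEFin big_const_seq count_predT iter_mulr_1.
have Js : perm_eq J s.
  by apply: uniq_perm => // y; rewrite in_fset.
rewrite (perm_size Js).
have [p0 p1] := andP (with_death_itv p).
rewrite lee_fin lerXn2r// ?nnegrE ?subr_ge0//.
  by rewrite /w/bernoulli_weight addr_ge0// mulr_ge0// ?subr_ge0.
rewrite /w /bernoulli_weight memNset; last by case.
rewrite mul0r add0r ler_piMl ?subr_ge0//.
(* The indicator vanishes when [U] is itself the empty up-family, whence an inequality only. *)
by case: (_ \in _).
Qed.

End peierls.

Section survival.
Context (K : realType) (r : K).

(** A finite alphabet makes contours countable by length. Coordinates range up to [2 N] because a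
    jump joins two points of one neighbourhood. *)
Definition decode (N : nat) (e : 'I_(4 * N).+1 * 'I_(4 * N).+1) : int * int :=
  (e.1%:Z - (N + N)%:Z, e.2%:Z - (N + N)%:Z).

Lemma decodeP (N : nat) (d : int * int) :
  `|d.1| <= (N + N)%:Z -> `|d.2| <= (N + N)%:Z -> exists e, @decode N e = d.
Proof.
case: d => x y /= hx hy.
exists (inord (absz (x + (N + N)%:Z)), inord (absz (y + (N + N)%:Z))).
by rewrite /decode /= !inordK; [congr (_, _); lia|lia|lia].
Qed.

(** The combinatorial conditions do not involve the field, so for a fixed word this is a cylinder or
    empty. *)
Definition sparse_dead (E : finType) (dec : E -> int * int) (U : upfamily r)
    (C : nat) (z : int * int) (l : seq (option (bool * E))) : set (field r) :=
  if uniq (sinks dec z l) && (size l <= C.+2 * size (sinks dec z l))%N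
  then [set f | forall y, y \in sinks dec z l -> f y <> U] else set0.

Definition words (L : finType) (n : nat) : seq (seq L) :=
  [seq val t | t <- enum {: n.-tuple L}].

(** The bound [5 ^ k] serves only to keep the union finite; the estimate drawn from it will not
    depend on [k]. *)
Lemma unroll_cover U N a b X1 X2 (k : nat) z (C : nat) :
  r <= N%:R -> @shrinking _ r U a b X1 X2 ->
  (`|a| + `|b|) * (N + N)%:Z <= C%:Z ->
  [set f : field r | ~~ unroll f k z] `<=`
  \big[setU/set0]_(n <- iota 1 (5 ^ k)) \big[setU/set0]_(l <- words _ n)
    sparse_dead (@decode N) U C z l.
Proof.
move=> rN shr hC f /= /negbTE fk.
have [l0 cl0 sl0] := unroll_contour rN (@decodeP N) shr hC fk.
have [l [cl ul ll0]] := contour_uniq cl0.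
have szl : (size l <= C.+2 * size (sinks (@decode N) z l))%N.
  by apply: contour_size cl => c; exact.
have l_gt0 : (0 < size l)%N by case: (l) cl => // -[].
rewrite -bigcup_seq; exists (size l).
  by rewrite /= mem_iota add1n ltnS l_gt0 (leq_trans ll0).
rewrite -bigcup_seq; exists l.
  by apply/mapP; exists (in_tuple l); rewrite ?mem_enum.
by rewrite /sparse_dead ul szl /=; case: cl.
Qed.

(* There are at most #|L| ^ n contours of length n, and each of them visits   *)
(* at least n / (C + 2) distinct deaths: eps is such that the nth term of the *)
(* union bound is at most 4^-n.                                               *)
Lemma shrinking_unroll U a b X1 X2 : @shrinking _ r U a b X1 X2 ->
  exists eps : K, 0 < eps < 1 /\
    forall (p : {i01 K}) (nu : probability (field r) K),
      cylinder_law nu (with_death p U) -> 1 - eps <= p%:num ->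
      forall k z, (nu [set f : field r | ~~ unroll f k z] <= (3^-1)%:E)%E.
Proof.
move=> shr; have [N rN] := nat_upper_bound r.
pose C := absz ((`|a| + `|b|) * (N + N)%:Z).
have hC : (`|a| + `|b|) * (N + N)%:Z <= C%:Z by rewrite /C abszE ler_norm.
pose L : finType := option (bool * ('I_(4 * N).+1 * 'I_(4 * N).+1)).
have L_gt0 : (0 < #|L|)%N by apply/card_gt0P; exists None.
have L_neq0 : (#|L|%:R : K) != 0 by rewrite pnatr_eq0 -lt0n.
pose q : K := (4 * #|L|%:R)^-1.
have q0 : 0 < q by rewrite invr_gt0 mulr_gt0// ltr0n.
have q1 : q < 1.
  rewrite invf_lt1 ?mulr_gt0// ?ltr0n// (@lt_le_trans _ _ 4)// ?ltr1n//.
  by rewrite ler_peMr// ler1n.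
exists (q ^+ C.+2); split; first by rewrite exprn_gt0//= exprn_ilt1// ltW.
move=> p nu nuU pq k z.
have pq' : 1 - p%:num <= q ^+ C.+2 by lra.
have [p0 p1] := andP (with_death_itv p).
have mS l : measurable (sparse_dead (@decode N) U C z l).
  rewrite /sparse_dead; case: ifP => // _.
  rewrite (_ : [set _ | _] = cylinder
    [fset y in sinks (@decode N) z l]%fset (fun=> [set V | V <> U])).
    exact: measurable_cylinder.
  by apply/seteqP; split => f /= H y yJ; apply: H; move: yJ; rewrite in_fset.
have nuS l : (nu (sparse_dead (@decode N) U C z l) <= (q ^+ size l)%:E)%E.
  rewrite /sparse_dead; case: ifP => [/andP[ul sl]|_]; last first.
    by rewrite measure0 lee_fin exprn_ge0// ltW.
  apply: (le_trans (dead_prob nuU ul)); rewrite lee_fin.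
  apply: (@le_trans _ _ ((q ^+ C.+2) ^+ size (sinks (@decode N) z l))).
    by rewrite lerXn2r// ?nnegrE ?exprn_ge0 ?subr_ge0// ltW.
  by rewrite -exprM ler_wiXn2l// ltW.
have mU n : measurable
    (\big[setU/set0]_(l <- words L n) sparse_dead (@decode N) U C z l).
  exact: bigsetU_measurable.
apply: (@le_trans _ _ (nu (\big[setU/set0]_(n <- iota 1 (5 ^ k))
    \big[setU/set0]_(l <- words L n) sparse_dead (@decode N) U C z l))).
  apply: le_measure; rewrite ?inE.
  - rewrite (_ : [set _ | _] = ~` [set f : field r | unroll f k z]).
      by apply: measurableC; exact: measurable_unroll.
    by apply/seteqP; split => f /= /negP.
  - exact: bigsetU_measurable.
  - exact: (unroll_cover rN shr hC).
apply: (le_trans (measure_bigsetU_seq_le _ _ mU)).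
apply: (@le_trans _ _ (\sum_(n <- iota 1 (5 ^ k)) ((4^-1 : K) ^+ n)%:E)%E).
  apply: lee_sum => n _; apply: (le_trans (measure_bigsetU_seq_le _ _ mS)).
  rewrite /words big_map big_enum /=.
  apply: (@le_trans _ _ (\sum_(t : n.-tuple L) (q ^+ n)%:E)%E).
    by apply: lee_sum => t _; rewrite (le_trans (nuS _))// size_tuple.
  rewrite sumEFin sumr_const card_tuple lee_fin -[leLHS]mulr_natl natrX -exprMn.
  by rewrite /q invfM mulrCA mulfV// mulr1.
by rewrite sumEFin lee_fin sum_quarter.
Qed.

(** By continuity from above, the uniform bound passes to the limit in [k]: the site [(0, -1)]
    survives with probability at least 2/3, which [\d_(config0 r)] excludes. *)
Lemma shrinking_stable U a b X1 X2 : 1 <= r -> @shrinking _ r U a b X1 X2 ->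
  exists eps : K, 0 < eps < 1 /\
    forall p : {i01 K}, 1 - eps <= p%:num < 1 ->
      exists mu : probability (config r) K,
        invariant_measure (with_death p U) mu /\
        ~ same_law mu \d_(config0 r).
Proof.
move=> r1 shr; have [eps [eps01 H]] := shrinking_unroll shr.
exists eps; split => // p /andP[peps _].
pose nu := field_prob p U.
have nuU : cylinder_law nu (with_death p U) by exact: field_prob_law.
exists (distribution nu (survivors 0)); split; first exact: survivors_invariant.
have s1 : (- r <= (-1)%:~R) && (-1 < 0 :> int) by rewrite lerN2 r1.
pose s : past r := exist (fun s : int => (- r <= s%:~R) && (s < 0)) _ s1.
pose A : set (config r) := [set w | w (0, s) = true].
have mA : measurable A by apply: sub_sigma_algebra; exists (0, s).
move=> /(_ A mA); rewrite diracE memNset// => mu0.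
pose B k := [set f : field r | unroll f k (0, -1)].
have AE : distribution nu (survivors 0) A = nu (\bigcap_k B k).
  congr (nu _); apply/seteqP; split => f /=.
    by move=> /asboolP fs k _; rewrite /B /=; have := fs k; rewrite /= add0r.
  by move=> fB; apply/asboolP => k; rewrite /= add0r; exact: fB.
have mB k : measurable (B k) by exact: measurable_unroll.
have Bdecr : nonincreasing_seq B.
  by move=> m n mn; apply/subsetPset => f; exact: unroll_le.
have B0 : (nu (B 0%N) < +oo)%E.
  by rewrite (le_lt_trans (probability_le1 _ _))// ltry.
have Bcvg := nonincreasing_cvg_mu B0 mB (bigcapT_measurable mB) Bdecr.
have cap_ge : ((1 - 3^-1)%:E <= nu (\bigcap_k B k))%E.
  rewrite -(cvg_lim _ Bcvg)//; apply: lime_ge; first exact: cvgP Bcvg.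
  apply: nearW => k /=; have := H p nu nuU peps k (0, -1).
  rewrite (_ : [set _ | _] = ~` B k); last first.
    by apply/seteqP; split => f /= /negP.
  rewrite probability_setC// leeBlDr//; last exact: fin_num_measure.
  by move=> h; rewrite EFinB leeBlDl.
have := eq_ind _ (fun e => ((1 - 3^-1)%:E <= e)%E) cap_ge _
  (etrans (esym AE) mu0).
by rewrite lee_fin mulr0n; lra.
Qed.

End survival.

(** * Extinction along lasting strips *)

Section blocks.
Context (K : realType) (r : K).
Variables (p : {i01 K}) (U : upfamily r) (nu : probability (field r) K).
Hypothesis nuU : cylinder_law nu (with_death p U).

(** The probability of the empty up-family at a site: [1 - p], or 1 if [U] is itself empty. *)
Let v0 : K := bernoulli_weight p%:num
  (fun b => pick_family U b \in [set upfamily0 r]).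

Lemma cylinder_dead (J : {fset int * int}) :
  nu (cylinder J (fun=> [set upfamily0 r])) = (v0 ^+ size J)%:E.
Proof.
rewrite nuU (eq_bigr (fun=> v0%:E)); last first.
  by move=> z _; exact: with_deathE.
by rewrite prodEFin big_const_seq count_predT iter_mulr_1.
Qed.

Lemma death_weight_bounds : 1 - p%:num <= v0 <= 1.
Proof.
have [p0 p1] := andP (with_death_itv p).
have U0 : [set upfamily0 r] (pick_family U false) by [].
rewrite /v0 /bernoulli_weight (mem_set U0).
by case: (_ \in _); rewrite /=; lra.
Qed.

Variable D : nat -> {fset int * int}.
Hypothesis tD : forall k l z, z \in D k -> z \in D l -> k = l.

Definition block_alive (k : nat) : set (field r) :=
  ~` cylinder (D k) (fun=> [set upfamily0 r]).

Lemma measurable_block_alive k : measurable (block_alive k).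
Proof. by apply: measurableC; exact: measurable_cylinder. Qed.

Lemma measurable_blocks_alive n :
  measurable (\big[setI/setT]_(k < n) block_alive k).
Proof. by apply: bigsetI_measurable => k _; exact: measurable_block_alive. Qed.

(** Carrying a dead set [J] disjoint from the blocks makes the induction work: block [n] being alive
    is the complement of [D n] being dead, and the latter is absorbed by replacing [J] with its
    union with [D n]. *)
Lemma blocks_alive_indep n (J : {fset int * int}) :
  (forall k z, (k < n)%N -> z \in D k -> z \notin J) ->
  nu (cylinder J (fun=> [set upfamily0 r]) `&`
    \big[setI/setT]_(k < n) block_alive k) =
  (v0 ^+ size J * \prod_(k < n) (1 - v0 ^+ size (D k)))%:E.
Proof.
elim: n J => [|n IH] J DJ.
  by rewrite !big_ord0 setIT mulr1 cylinder_dead.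
rewrite big_ord_recr /= setIA.
set C := cylinder J _; set R := \big[setI/setT]_(k < n) _.
have mC : measurable C by exact: measurable_cylinder.
have mR : measurable R by exact: measurable_blocks_alive.
have DJ' k z : (k < n)%N -> z \in D k -> z \notin J.
  by move=> kn; apply: DJ; rewrite (ltn_trans kn).
rewrite (_ : C `&` R `&` block_alive n = C `&` R `\`
    (cylinder (J `|` D n)%fset (fun=> [set upfamily0 r]) `&` R)); last first.
  apply/seteqP; split => f /=.
    move=> [[Cf Rf] Df]; split => // -[H _]; apply: Df => z zD.
    by apply: H; rewrite in_fsetU zD orbT.
  move=> [[Cf Rf] H]; split => // Df; apply: H; split => // z.
  by rewrite in_fsetU => /orP[/Cf|/Df].
set C' := cylinder _ _ `&` R.
have mC' : measurable C'.
  by apply: measurableI => //; exact: measurable_cylinder.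
have sub : C' `<=` C `&` R.
  by move=> f [H Rf]; split => // z zJ; apply: H; rewrite in_fsetU zJ.
transitivity (nu (C `&` R) - nu C')%E.
  rewrite measureD//; [by rewrite (setIidr sub)|exact: measurableI|].
  by rewrite (le_lt_trans (probability_le1 _ _))// ?ltry//; exact: measurableI.
rewrite IH// IH; last first.
  move=> k z kn zk; rewrite in_fsetU (negbTE (DJ' _ _ kn zk))/=.
  by apply/negP => /(tD zk) kE; rewrite kE ltnn in kn.
have -> : size (J `|` D n)%fset = (size J + size (D n))%N.
  apply/eqP; rewrite -[_ == _]/(#|`(J `|` D n)%fset| == #|`J| + #|`D n|)%N.
  rewrite -cardfsUI.
  have -> : (J `&` D n)%fset = fset0.
    apply/fsetP => z; rewrite in_fsetI in_fset0; apply/negbTE/negP.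
    by move=> /andP[zJ /(DJ n z (leqnn _))]; rewrite zJ.
  by rewrite cardfs0 addn0.
by rewrite -EFinB big_ord_recr /= exprD; congr EFin; ring.
Qed.

Lemma blocks_alive_prob n M : (forall k, (size (D k) <= M)%N) ->
  (nu (\big[setI/setT]_(k < n) block_alive k) <=
    ((1 - (1 - p%:num) ^+ M) ^+ n)%:E)%E.
Proof.
move=> DM; have [p0 p1] := andP (with_death_itv p).
have [v0p v01] := andP death_weight_bounds.
have q0 : 0 <= 1 - p%:num by lra.
have v00 : 0 <= v0 by lra.
have -> : \big[setI/setT]_(k < n) block_alive k =
    cylinder fset0 (fun=> [set upfamily0 r]) `&`
    \big[setI/setT]_(k < n) block_alive k.
  by rewrite (_ : cylinder _ _ = setT) ?setTI//; apply/seteqP; split.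
rewrite blocks_alive_indep// cardfs0 expr0 mul1r lee_fin.
rewrite -[X in _ <= _ ^+ X]card_ord -prodr_const; apply: ler_prod => k _.
rewrite subr_ge0 exprn_ile1//= lerD2l lerN2.
apply: (@le_trans _ _ (v0 ^+ M)); first by rewrite lerXn2r// nnegrE.
by rewrite ler_wiXn2l.
Qed.

End blocks.

(** * A probability space carrying the process from a given initial law *)

Section product_space.
Context (K : realType) (r : K).
Variables (p : {i01 K}) (U : upfamily r) (mu : probability (config r) K).

Let T : measurableType _ := (config r * measurableTypeR K)%type.
Let P : probability T K := (mu \x @unit_measure K)%E.

Definition death_field (z : int * int) (a : config r * measurableTypeR K) :
  upfamily r := digit_field p U a.2 z.

Lemma measurable_death_field z : measurable_fun setT (death_field z).
Proof.
move=> _ A _; rewrite setTI.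
have := @measurable_snd _ _ (config r) (measurableTypeR K) measurableT _
  (measurable_digit_field p U measurableT (measurable_coord z A)).
by rewrite !setTI.
Qed.

HB.instance Definition _ z :=
  isMeasurableFun.Build _ _ _ _ (death_field z) (measurable_death_field z).

Definition initial_config (a : config r * measurableTypeR K) : config r := a.1.

Lemma measurable_initial_config : measurable_fun setT initial_config.
Proof. exact: measurable_fst. Qed.

HB.instance Definition _ :=
  isMeasurableFun.Build _ _ _ _ initial_config measurable_initial_config.

Lemma death_field_prob (B : set (field r)) : measurable B ->
  P [set a | B (digit_field p U a.2)] = field_prob p U B.
Proof.
move=> mB; transitivity (P (setT `*` (digit_field p U @^-1` B))).
  by congr (P _); apply/seteqP; split => a //= [].
have mD : measurable (digit_field p U @^-1` B).
  by have := measurable_digit_field p U measurableT mB; rewrite setTI.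
apply: etrans (product_measure1E _ _ measurableT mD) _.
rewrite -[RHS]mul1e; congr (_ * _)%E; exact: probability_setT.
Qed.

Lemma initial_config_law :
  same_law (distribution P (initial_config : {RV P >-> config r})) mu.
Proof.
move=> A mA; transitivity (P (A `*` setT)).
  by congr (P _); apply/seteqP; split => a //= [].
apply: etrans (product_measure1E _ _ mA measurableT) _.
rewrite -[RHS]mule1; congr (_ * _)%E; exact: probability_setT.
Qed.

Lemma death_field_iid :
  iid_field (fun z => death_field z : {RV P >-> upfamily r}) (with_death p U).
Proof.
have one z A : P (death_field z @^-1` A) = with_death p U A.
  transitivity (field_prob p U (cylinder [fset z]%fset (fun=> A))).
    rewrite -death_field_prob; last exact: measurable_cylinder.
    congr (P _); apply/seteqP; split => a /=.
      by move=> aA y; rewrite in_fset1 => /eqP ->.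
    by apply; rewrite in_fset1.
  by rewrite field_prob_law big_seq_fset1.
split => [z A _|J A _]; first exact: one.
transitivity (field_prob p U (cylinder J A)).
  by rewrite -death_field_prob//; exact: measurable_cylinder.
rewrite field_prob_law; apply: eq_bigr => z _; exact/esym/one.
Qed.

Lemma death_field_indep : indep_of_field (initial_config : {RV P >-> config r})
  (fun z => death_field z : {RV P >-> upfamily r}).
Proof.
move=> A B mA mB.
(* The field is a function of the second coordinate alone, so the preimages under [snd] form a
   sigma-algebra containing all its generating events. *)
have [C mC ->] : exists2 C, measurable C & B = snd @^-1` C.
  have : preimage_set_system setT snd (@measurable _ (measurableTypeR K)) B.
    apply: (smallest_sub _ _ mB) => [|_ [z [V [_ ->]]]].
      exact/sigma_algebra_preimage/sigma_algebra_measurable.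
    exists (digit_field p U @^-1` [set f | V (f z)]); last by rewrite setTI.
    by have := measurable_digit_field p U measurableT (measurable_coord z V);
      rewrite setTI.
  by move=> [C mC <-]; exists C; rewrite ?setTI.
have -> : initial_config @^-1` A `&` snd @^-1` C = A `*` C by [].
have -> : initial_config @^-1` A = A `*` setT.
  by apply/seteqP; split => a //= [].
have -> : snd @^-1` C = setT `*` C :> set T.
  by apply/seteqP; split => a //= [].
apply: etrans (product_measure1E _ _ mA mC) _.
congr (_ * _)%E; apply/esym.
  apply: etrans (product_measure1E _ _ mA measurableT) _.
  rewrite -[RHS]mule1; congr (_ * _)%E; exact: probability_setT.
apply: etrans (product_measure1E _ _ measurableT mC) _.
rewrite -[RHS]mul1e; congr (_ * _)%E; exact: probability_setT.
Qed.

End product_space.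

Section extinction.
Context (K : realType) (r : K).

(* The points of the strip |lin_form a b - c| <= C at times in [k N, k N + N[;*)
(* e - C is the value of lin_form a b - c.                                    *)
Definition strip_sites (N C : nat) (a b c : int) (k : nat) : seq (int * int) :=
  [seq (((c + (e%:Z - C%:Z) - b * (k * N + j)%:Z) %/ a)%Z, (k * N + j)%:Z)
  | j <- iota 0 N, e <- iota 0 C.*2.+1].

Lemma strip_sites_time N C a b c k z : z \in strip_sites N C a b c k ->
  (k * N)%:Z <= z.2 < (k.+1 * N)%:Z.
Proof.
move=> /allpairsP[[j e] /= [+ _ ->]] /=; rewrite mem_iota add0n => /andP[_ jN].
by rewrite mulSn; lia.
Qed.

Lemma mem_strip_sites N C a b c k x (t : int) : 0 < a ->
  (k * N)%:Z <= t < (k.+1 * N)%:Z -> `|lin_form a b (x, t) - c| <= C%:Z ->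
  (x, t) \in strip_sites N C a b c k.
Proof.
move=> a0 tk xC; apply/allpairsP.
pose e := absz (lin_form a b (x, t) - c + C%:Z).
have eE : e%:Z - C%:Z = lin_form a b (x, t) - c by rewrite /e; lia.
have tE : t = (k * N + (`|t| - k * N))%N%:Z by move: tk; rewrite mulSn; lia.
exists ((`|t| - k * N)%N, e); split.
- by rewrite mem_iota add0n leq0n /=; move: tk; rewrite mulSn; lia.
- by rewrite mem_iota add0n leq0n /= ltnS -addnn /e; lia.
- rewrite /= -tE eE; congr (_, _).
  rewrite (_ : _ - b * t = x * a) ?mulzK ?gt_eqF//.
  by rewrite /lin_form /=; ring.
Qed.

Variables (p : {i01 K}) (U : upfamily r) (mu : probability (config r) K).

(** By invariance the probability of a one is the same at a late time. A wholly dead block covers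
    the strip during [N] consecutive times and hence keeps it at zero afterwards, so a one requires
    all [n] disjoint blocks to be alive; the resulting bound [q ^ n] tends to 0. *)
Lemma lasting_coordinate a b z : p%:num < 1 -> lasting U a b ->
  invariant_measure (with_death p U) mu -> mu [set w | w z = true] = 0%E.
Proof.
move: z => [x s] plt1 last inv; have [N rN] := nat_upper_bound r.
have [a0 _] := last.
pose C := absz ((`|a| + `|b|) * N%:Z).
have CE : (`|a| + `|b|) * N%:Z <= C%:Z by rewrite /C abszE ler_norm.
have hC (y : nbhd r) : `|lin_form a b (val y)| <= C%:Z.
  have [h1 _ _] := nbhd_bounds rN y.
  exact: le_trans (lin_form_le a b h1 (nbhd_norm2 rN y)) CE.
pose M := (N * C.*2.+1)%N.
pose q : K := 1 - (1 - p%:num) ^+ M.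
have [p0 p1] := andP (with_death_itv p).
have q01 : 0 <= q < 1.
  by rewrite subr_ge0 exprn_ile1 ?gtrBl ?exprn_gt0//=; lra.
pose A : set (config r) := [set w | w (x, s) = true].
have mA : measurable A by apply: sub_sigma_algebra; exists (x, s).
have bound n : (mu A <= (q ^+ n)%:E)%E.
  (* As [val s] is at least [- N], the observed point comes after all [n] blocks; [c] centres the
     strip on it. *)
  pose t := (n * N + N)%N; pose c := lin_form a b (x, t%:Z + val s).
  pose D k := [fset z in strip_sites N C a b c k]%fset.
  have tD k l z : z \in D k -> z \in D l -> k = l.
    rewrite !in_fset => /strip_sites_time h1 /strip_sites_time h2.
    have h3 : ((k * N) < l.+1 * N)%N by lia.
    have h4 : ((l * N) < k.+1 * N)%N by lia.
    by move: h3 h4; rewrite !ltn_mul2r => /andP[_ ?] /andP[_ ?]; lia.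
  have DM k : (size (D k) <= M)%N.
    apply: (@leq_trans (size (strip_sites N C a b c k))).
      by apply: uniq_leq_size => [|y]; rewrite ?fset_uniq ?in_fset.
    by rewrite size_allpairs !size_iota.
  pose P : probability (config r * measurableTypeR K)%type K :=
    (mu \x @unit_measure K)%E.
  pose R := \big[setI/setT]_(k < n) @block_alive _ r D k.
  pose u (w : config r * measurableTypeR K) : field r := digit_field p U w.2.
  have -> : mu A = P [set w | eta (u w) w.1 x (t%:Z + val s) = true].
    by rewrite -(inv _ _ P _ _ (death_field_iid p U mu)
      (@initial_config_law _ _ mu) (@death_field_indep _ _ p U mu) t A mA).
  have mR : measurable R by exact: measurable_blocks_alive.
  apply: (@le_trans _ _ (P [set w | R (u w)])); last first.
    rewrite death_field_prob//.
    exact: (blocks_alive_prob (@field_prob_law _ r p U) tD n DM).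
  have mu_ : measurable_fun setT u.
    exact: (measurableT_comp (measurable_digit_field p U) measurable_snd).
  have mpair : measurable_fun setT (fun w => (w.1, u w)).
    exact: (measurable_fun_pair measurable_fst mu_).
  apply: le_measure; rewrite ?inE.
  - have := mpair measurableT _ (measurable_eta x (t%:Z + val s)).
    by rewrite setTI.
  - by have := mu_ measurableT _ mR; rewrite setTI.
  - move=> w /= etaw; rewrite /R -bigcap_mkord => k /= kn dead.
    have dk : (k.+1 * N <= n * N)%N by rewrite leq_mul2r kn orbT.
    have /andP[sN s0] := past_bounds rN s.
    suff : eta (u w) w.1 x (t%:Z + val s) = false by rewrite etaw.
    apply: (@lasting_strip _ _ _ rN U (u w) w.1 a b C%:Z c (k.+1 * N)%:Z last).
    + by move=> y V; rewrite /u /digit_field /pick_family; case: ifP.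
    + exact: hC.
    + by [].
    + move=> y t' ht' hy.
      have ht'' : (k * N)%:Z <= t' < (k.+1 * N)%:Z.
        by move: ht'; rewrite mulSn PoszD addrAC subrr add0r.
      have t'0 : 0 <= t' by case/andP: ht'' => h _; exact: le_trans h.
      rewrite -(gez0_abs t'0) eta_step gez0_abs// dead.
        by apply/asboolP.
      by rewrite in_fset mem_strip_sites.
    + by clear -dk sN; rewrite /t; lia.
    + by rewrite /c subrr normr0.
have mu0 : (mu A <= 0)%E.
  have muAfin : mu A \is a fin_num by exact: fin_num_measure.
  rewrite -(fineK muAfin) lee_fin.
  have q_lt1 : `|q| < 1 by case/andP: q01 => ? ?; rewrite ger0_norm.
  apply: (cvgr_to_ge (cvg_expr q_lt1)); apply: nearW => n.
  by rewrite -lee_fin fineK.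
by apply/eqP; rewrite eq_le mu0 measure_ge0.
Qed.

(** A configuration other than [config0 r] has a one at some coordinate; there are countably many
    coordinates, and each contributes a null event. *)
Lemma lasting_extinct a b : p%:num < 1 -> lasting U a b ->
  invariant_measure (with_death p U) mu -> same_law mu \d_(config0 r).
Proof.
move=> plt1 last inv A mA.
pose S (z : int * past r) := [set w : config r | w z = true].
have mS z : measurable (S z) by apply: sub_sigma_algebra; exists z.
pose F (n : nat) := if choice.unpickle n is Some z then S z else set0.
have negF : mu.-negligible (\bigcup_n F n).
  apply: negligible_bigcup => n; rewrite /F.
  case: choice.unpickle => [z|]; last exact: negligible_set0.
  by apply/negligibleP => //; apply: lasting_coordinate last inv.
have sub B : ~ B (config0 r) -> B `<=` \bigcup_n F n.
  move=> nB w Bw; apply: contrapT => nF; apply: nB.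
  suff <- : w = config0 r by [].
  apply/funext => z; apply/negbTE/negP => wz; apply: nF.
  by exists (choice.pickle z); [exact: I|rewrite /F choice.pickleK].
have null B : measurable B -> ~ B (config0 r) -> mu B = 0%E.
  by move=> mB nB; apply/negligibleP => //; apply: negligibleS negF; exact: sub.
rewrite diracE; have [A0|A0] := pselect (A (config0 r)).
  have nA : mu (~` A) = 0%E.
    by apply: null => [|H]; [exact: measurableC|exact: H A0].
  rewrite mem_set//= -[A]setCK probability_setC; last exact: measurableC.
  by rewrite nA sube0.
by rewrite memNset// null.
Qed.

End extinction.

Theorem theorem1p9 (K : realType) (r : K) (hr : 1 <= r) (U : upfamily r) :
  eroder U <->
  exists eps : K, 0 < eps < 1 /\
    forall p : {i01 K}, 1 - eps <= p%:num < 1 ->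
      exists mu : probability (config r) K,
        invariant_measure (with_death p U) mu /\
        ~ same_law mu \d_(config0 r).
Proof.
have [N rN] := nat_upper_bound r.
have r0 : 0 <= r by rewrite (le_trans _ hr).
have [[a [b [X1 [X2 shr]]]]|[a [b last]]] := shrinking_or_lasting rN U.
  by split=> _; [exact: shrinking_stable shr|exact (shrinking_eroder rN shr)].
split=> [/(lasting_not_eroder rN r0 last)//|[eps [/andP[eps0 eps1] H]]].
(* A single admissible [p < 1] contradicts extinction; halving [eps] makes the death rate positive
   and within the allowed range. *)
have p0 : 0 <= 1 - eps / 2 by lra.
have p1 : 1 - eps / 2 <= 1 by lra.
have plt1 : (Itv01 p0 p1)%:num < 1 by rewrite /=; lra.
have [|mu [inv []]] := H (Itv01 p0 p1); last exact: lasting_extinct last inv.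
by rewrite plt1 andbT /=; lra.
Qed.
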